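(* Let $d\ge2$. There exists $\beta_0(d,0)>0$, depending only on $d$, such that for every real $\beta$ with $|\beta|\le\beta_0(d,0)$, every increasing sequence $\Lambda_1\subseteq\Lambda_2\subseteq\cdots$ of finite subsets of $\mathbb Z^d$ with $\bigcup_j\Lambda_j=\mathbb Z^d$, and every loop sequence $(l_1,l_2,\dots,l_n)$, the following limits exist and satisfy $$\lim_{N\to\infty}\frac{\langle W_{l_1}W_{l_2}\cdots W_{l_n}\rangle_{\Lambda_N,N,\beta}}{N^n}=\prod_{i=1}^n\lim_{N\to\infty}\frac{\langle W_{l_i}\rangle_{\Lambda_N,N,\beta}}{N},$$ where $\langle\cdot\rangle_{\Lambda,N,\beta}$ is expectation in $SU(N)$ lattice gauge theory.
   Context: **Loops.** Edges are directed nearest-neighbour edges $e=(u(e),v(e))$ of $\mathbb Z^d$, with $e^{-1}$ the reversed edge; $e$ is positively oriented if $u(e)$ is lexicographically smaller than $v(e)$. A loop is a class, modulo cyclic permutation, of closed paths $e_1\cdots e_n$ ($v(e_i)=u(e_{i+1})$, $v(e_n)=u(e_1)$) without backtracks, i.e. with $e_{i+1}\ne e_i^{-1}$ for all $i$ ($e_{n+1}:=e_1$); the null loop has no edges. A loop sequence is a finite sequence of loops (modulo inserting or deleting null loops). A plaquette is a closed path $e_1e_2e_3e_4$ with $e_i\neq e_j^{-1}$ for all $i,j$, up to cyclic equivalence; it is positively oriented if it has a representative for which $u(e_1)$ is lexicographically smallest and $u(e_2)$ second smallest among its vertices. **Gauge theory.** For finite $\Lambda\subset\mathbb Z^d$,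 $E^+_\Lambda$ is the set of positively oriented edges with both endpoints in $\Lambda$ and $\mathcal P^+_\Lambda$ the set of positively oriented plaquettes with all edges in $\Lambda$. A configuration is $Q=(Q_e)_{e\in E^+_\Lambda}$ with $Q_e\in SU(N)$, $Q_{e^{-1}}:=Q_e^{*}$. With $\sigma$ the normalized Haar measure on $SU(N)$, $$d\mu_{\Lambda,N,\beta}(Q)=Z_{\Lambda,N,\beta}^{-1}\exp\Bigl(N\beta\sum_{p\in\mathcal P^+_\Lambda}\mathrm{Re}\,\mathrm{Tr}(Q_p)\Bigr)\prod_{e\in E^+_\Lambda}d\sigma(Q_e),\qquad Q_p=Q_{e_1}Q_{e_2}Q_{e_3}Q_{e_4},$$ and $\langle f\rangle_{\Lambda,N,\beta}=\int f\,d\mu_{\Lambda,N,\beta}$. For a loop $l=e_1\cdots e_n$ with edges in $\Lambda$, $W_l=\mathrm{Tr}(Q_{e_1}\cdots Q_{e_n})$ (and $W_\emptyset=N$). *)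

(* Defs.v *)
From HB Require Import structures.
From mathcomp Require Import all_boot all_order all_algebra finmap.
From mathcomp Require Import generic_quotient spectral complex.
From mathcomp Require Import all_classical all_reals all_analysis.

Set Implicit Arguments.
Unset Strict Implicit.
Unset Printing Implicit Defensive.
Import Order.TTheory GRing.Theory Num.Theory.
Import numFieldNormedType.Exports.

Local Open Scope classical_set_scope.
Local Open Scope ring_scope.
Local Open Scope quotient_scope.

Definition vertex (d : nat) := d.-tuple int.

Definition vlt (d : nat) (x y : vertex d) : bool :=
  ((x : d.-tuplelexi int) < (y : d.-tuplelexi int))%O.

(* A directed edge is the pair (u(e), v(e)); that u(e) and v(e) are nearest
   neighbours is the separate predicate [nn]. *)
Definition edge (d : nat) : Type := (vertex d * vertex d)%type.

HB.instance Definition _ d := Countable.on (edge d).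

Definition nn (d : nat) (e : edge d) : bool :=
  (\sum_(i < d) `|tnth e.1 i - tnth e.2 i| == 1 :> int).

Definition einv (d : nat) (e : edge d) : edge d := (e.2, e.1).

Definition epos (d : nat) (e : edge d) : bool := vlt e.1 e.2.

Definition closed_path (d : nat) (s : seq (edge d)) : bool :=
  all (@nn d) s && cycle (fun e f => e.2 == f.1) s.

(* [cycle] also relates the last edge to the first one. *)
Definition loop_path (d : nat) (s : seq (edge d)) : bool :=
  closed_path s && cycle (fun e f => f != einv e) s.

Definition loop_rep (d : nat) := {s : seq (edge d) | loop_path s}.

HB.instance Definition _ d := Choice.on (loop_rep d).

Definition cyc_eq (d : nat) (s t : loop_rep d) : bool :=
  [exists i : 'I_(size (val s)).+1, val t == rot i (val s)].

Lemma cyc_eqP d (s t : loop_rep d) :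
  reflect (exists i, val t = rot i (val s)) (cyc_eq s t).
Proof.
apply: (iffP existsP) => [[i /eqP ->]|[i e]]; first by exists i.
have [ilt|ige] := ltnP i (size (val s)).+1.
  by exists (Ordinal ilt); rewrite e.
by exists ord0; rewrite e rot0 rot_oversize// ltnW.
Qed.

Lemma cyc_eq_equiv d : equiv_class_of (@cyc_eq d).
Proof.
split.
- by move=> s; apply/cyc_eqP; exists 0%N; rewrite rot0.
- suff sym s t : @cyc_eq d s t -> cyc_eq t s by move=> s t; apply/idP/idP; apply: sym.
  move=> /cyc_eqP[i e]; apply/cyc_eqP; exists (size (val t) - i)%N.
  by rewrite -/(rotr i (val t)) e rotK.
- move=> t s u /cyc_eqP[i e] /cyc_eqP[j e']; apply/cyc_eqP.
  by exists (rot_add (val s) i j); rewrite e' e rot_rot_add.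
Qed.

Canonical cyc_eq_rel d := EquivRelPack (@cyc_eq_equiv d).

(* Closed paths without backtracks modulo cyclic permutation; the null loop
   is the class of the empty path. *)
Definition loop (d : nat) := {eq_quot @cyc_eq d}.

HB.instance Definition _ d := Choice.on (loop d).

Definition plaquette_path (d : nat) (s : seq (edge d)) : bool :=
  [&& size s == 4, closed_path s & allrel (fun e f => e != einv f) s s].

(* Every positively oriented plaquette (a cyclic class) has exactly one
   representative e1 e2 e3 e4 with u(e1) smallest and u(e2) second smallest;
   positively oriented plaquettes are identified with these paths. *)
Definition pos_plaquette (d : nat) (s : seq (edge d)) : bool :=
  plaquette_path s &&
  (if map fst s is u1 :: u2 :: us then vlt u1 u2 && all (vlt u2) us else false).

Definition edges (d : nat) (L : {fset vertex d}) : {fset edge d} :=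
  [fset e in (L `*` L)%fset | nn e]%fset.

Definition pos_edges (d : nat) (L : {fset vertex d}) : {fset edge d} :=
  [fset e in edges L | epos e]%fset.

(* R[i] has the topology of its norm, and matrices the entrywise one. *)
HB.instance Definition _ (R : realType) := NormedModule.copy R[i] R[i]^o.

Record SU (R : realType) (N : nat) := MkSU {
  suval : 'M[R[i]]_N ;
  suvalP : (suval \is unitarymx) && (\det suval == 1) }.

HB.instance Definition _ R N := [isSub for @suval R N].
HB.instance Definition _ R N := [Choice of SU R N by <:].

Lemma SU1P (R : realType) N :
  ((1%:M : 'M[R[i]]_N) \is unitarymx) && (\det (1%:M : 'M[R[i]]_N) == 1).
Proof. by rewrite det1 eqxx andbT; apply/unitarymxP; rewrite trmx1 map_mx1 mulmx1. Qed.

Definition SU1 (R : realType) N : SU R N := MkSU (SU1P R N).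

Lemma SU_mulP (R : realType) N (g h : SU R N) :
  (suval g *m suval h \is unitarymx) && (\det (suval g *m suval h) == 1).
Proof.
case/andP: (suvalP g) => gU /eqP g1; case/andP: (suvalP h) => hU /eqP h1.
by rewrite mul_unitarymx//= det_mulmx g1 h1 mulr1.
Qed.

Definition SU_mul (R : realType) N (g h : SU R N) : SU R N := MkSU (SU_mulP g h).

HB.instance Definition _ R N := isPointed.Build (SU R N) (SU1 R N).

HB.instance Definition _ R N :=
  Topological.copy (SU R N) (initial_topology (@suval R N)).

(* SU(N) has the subspace topology and the Borel sigma-algebra. *)
HB.instance Definition _ R N :=
  Measurable.copy (SU R N) (g_sigma_algebraType (@open (SU R N))).

(* SU(N) is compact, hence it carries exactly one such probability. *)
Definition is_haar (R : realType) N (sigma : probability (SU R N) R) : Prop :=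
  forall (g : SU R N) (A : set (SU R N)), measurable A ->
    sigma (SU_mul g @` A) = sigma A.

Section power_measure.
Context (disp : measure_display) (T : measurableType disp) (R : realType).

Definition tcons n (x : T * n.-tuple T) : n.+1.-tuple T :=
  [the n.+1.-tuple T of x.1 :: x.2].

Lemma measurable_tcons n : measurable_fun [set: T * n.-tuple T] (@tcons n).
Proof. exact: measurable_cons. Qed.

HB.instance Definition _ n :=
  isMeasurableFun.Build _ _ _ _ (@tcons n) (@measurable_tcons n).

Fixpoint power_measure (P : probability T R) (n : nat) :
    probability (n.-tuple T) R :=
  match n with
  | 0 => \d_ [tuple]
  | m.+1 => distribution (P \x power_measure P m)%E (@tcons m)
  end.

End power_measure.

Section gauge.
Context (R : realType) (N d : nat) (L : {fset vertex d}).

(* A configuration lists the Q_e along the enumeration of [pos_edges L]. *)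
Definition config := #|` pos_edges L|.-tuple (SU R N).

(* Q_e for an arbitrary edge e of L; the identity if e is not an edge of L. *)
Definition edge_mx (Q : config) (e : edge d) : 'M[R[i]]_N :=
  if e \in pos_edges L then suval (nth (SU1 R N) Q (index e (pos_edges L)))
  else if einv e \in pos_edges L then
    map_mx Num.conj (suval (nth (SU1 R N) Q (index (einv e) (pos_edges L))))^T
  else 1%:M.

Definition path_mx (Q : config) (s : seq (edge d)) : 'M[R[i]]_N :=
  \prod_(e <- s) edge_mx Q e.

(* Independent of the representative of the loop: see [wilson_pi]. *)
Definition wilson (l : loop d) (Q : config) : R[i] :=
  \tr (path_mx Q (val (repr l))).

Lemma path_mx_cat (Q : config) s t :
  path_mx Q (s ++ t) = path_mx Q s *m path_mx Q t.
Proof. by rewrite /path_mx big_cat mulmxE. Qed.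

Lemma wilson_pi (s : loop_rep d) (Q : config) :
  wilson (\pi_(loop d) s) Q = \tr (path_mx Q (val s)).
Proof.
rewrite /wilson; case: piP => t /eqmodP/= /cyc_eqP[i ->].
by rewrite /rot path_mx_cat mxtrace_mulC -path_mx_cat cat_take_drop.
Qed.

Definition boltzmann (beta : R) (Q : config) : R :=
  expR (N%:R * beta *
    \sum_(p : 4.-tuple (edges L) | pos_plaquette (map val p))
      complex.Re (\tr (path_mx Q (map val p)))).

Variable sigma : probability (SU R N) R.

Definition partition_function (beta : R) : R :=
  \int[power_measure sigma #|` pos_edges L|]_Q boltzmann beta Q.

(* Integral of a real function against the Gibbs measure mu, whose density
   with respect to the product Haar measure is Z^-1 * boltzmann *)
Definition gibbs_integral (beta : R) (f : config -> R) : R :=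
  \int[power_measure sigma #|` pos_edges L|]_Q
    ((partition_function beta)^-1 * boltzmann beta Q * f Q).

Definition gibbs_expectation (beta : R) (f : config -> R[i]) : R[i] :=
  Complex (gibbs_integral beta (fun Q => complex.Re (f Q)))
          (gibbs_integral beta (fun Q => complex.Im (f Q))).

End gauge.

(* Main.v *)
Require Import Defs.
From HB Require Import structures.
From mathcomp Require Import all_boot all_order all_algebra finmap.
From mathcomp Require Import generic_quotient spectral complex.
From mathcomp Require Import all_classical all_reals all_analysis.
From mathcomp Require Import measurable_realfun.
From mathcomp Require Import perm ring lra zify.
(** Factorization of Wilson loops at strong coupling.

    Everything is proved for arbitrary words in the directed edges, not only
    for loops: write phi_N(w_1, ..., w_k) for the Gibbs expectation of
    Tr Q_{w_1} ... Tr Q_{w_k} divided by N^k. Working with words removes all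
    bookkeeping about closedness, cyclic classes and backtracks, and the
    Wilson loops are recovered by choosing representatives of the loops.

    Finite N. The invariance of Haar measure under left multiplication of one
    edge variable by a curve in SU(N) gives an integration by parts formula
    for every traceless direction ([ibp_traceless]). Contracting it over all
    matrix units yields the Schwinger-Dyson equation ([phi_recursion]): up to
    an error O(1/N^2), phi_N(e b, t) equals a finite linear combination, with
    real coefficients that do not depend on N, of values phi_N(x ++ t). The
    word e b is cut in two at each further occurrence of e or of its inverse
    (splitting), or merged with a plaquette through e (deformation), or left
    alone while such a plaquette is added to the sequence; the last kind comes
    from the determinant constraint and, like deformation, carries a factor
    beta. Only the first word is modified and the rest t is a spectator.

    Contraction. Give a word of length n >= 1 the weight K^n / (64 (n + 1)^2)
    with K = 1024, the empty word the weight 1, and a sequence the product of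
    the weights of its words. Splittings are controlled because a convolution
    of n^-2 with itself is again of order n^-2, and the remaining terms because
    beta is small; so the recursion operator has norm at most 1/2
    ([loop_op_weight]). Hence bounded functions that satisfy the recursion
    asymptotically and vanish on the empty sequence tend to 0
    ([contraction_cvg0]).

    Conclusion. This principle is used twice. Applied to phi_N - phi_M it shows
    that phi_N(s) is a Cauchy sequence; the recursion is eventually the same
    for N and M because the set of plaquettes of Lambda_N through a given edge
    grows with N and has a size bounded in terms of d ([touching_stable]).
    Applied to phi_N(s ++ t) - phi_N(s) phi_N(t) with t fixed, which inherits
    the recursion because t is a spectator, it shows that the limit is
    multiplicative ([phi_lim_cat]). *)

Set Implicit Arguments.
Unset Strict Implicit.
Unset Printing Implicit Defensive.
Import Order.TTheory GRing.Theory Num.Theory.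
Import numFieldNormedType.Exports.
Local Open Scope classical_set_scope.
Local Open Scope ring_scope.

(** * Weights on word sequences and the contraction principle *)

Section weight.
Variables (R : realType) (E : Type).
Implicit Types (s t : seq (seq E)).

(** Sealed because the numeral would otherwise be evaluated when its powers
    are compared. *)
Definition growth : R := locked 1024.

Lemma growthE : growth = 1024. Proof. by rewrite /growth -lock. Qed.

Lemma growth_ge1 : 1 <= growth. Proof. by rewrite growthE ler1n. Qed.

Lemma growth_ge0 : 0 <= growth. Proof. by rewrite growthE ler0n. Qed.

Lemma growthX_ge0 n : 0 <= growth ^+ n.
Proof. exact: exprn_ge0 growth_ge0. Qed.

(** The factor (n + 1)^-2 makes the weight almost stable under convolution
    ([conv_weight_same], [conv_weight_opp]). The exponential makes the weight at
    least 1, so that bounded functions are bounded by the weight, and makes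
    shorter words much cheaper. The empty word has weight 1 since its
    normalized trace is 1. *)
Definition weight (n : nat) : R :=
  if n is 0 then 1 else 64^-1 * growth ^+ n / n.+1%:R ^+ 2.

Definition weights s : R := \prod_(w <- s) weight (size w).

Lemma weights_cat s t : weights (s ++ t) = weights s * weights t.
Proof. by rewrite /weights big_cat. Qed.

Lemma weights_cons w s : weights (w :: s) = weight (size w) * weights s.
Proof. by rewrite /weights big_cons. Qed.

(** Because (n + 2)^2 <= 4^(n + 1), which is far below 1024^(n + 1) / 64. *)
Lemma weight_ge1 n : 1 <= weight n.
Proof.
case: n => [//|n]; rewrite /weight ler_pdivlMr ?exprn_gt0 ?ltr0n// mul1r.
have h m : (m.+2 <= 2 ^ m.+1)%N.
  elim: m => // m ih; rewrite expnS mul2n -addnn.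
  by apply: (@leq_add 1 m.+2) => //; exact: ltn_trans ih.
have h2 : (n.+2%:R : R) ^+ 2 <= (2 ^+ n.+1) ^+ 2.
  by rewrite -!natrX ler_nat leq_exp2r.
apply: (le_trans h2); rewrite -exprM mulnC exprM expr2.
have -> : (2 * 2 : R) = 4 by ring.
have -> : growth = 256 * 4 by rewrite growthE; ring.
rewrite exprMn mulrA ler_peMl ?exprn_ge0// ?ler0n//.
rewrite exprS mulrA; apply: (@le_trans _ _ (4 * 1)); first by lra.
apply: ler_pM; rewrite ?exprn_ege1 ?ler01//; lra.
Qed.

Lemma weight_gt0 n : 0 < weight n.
Proof. exact: lt_le_trans (weight_ge1 n). Qed.

Lemma weights_ge1 s : 1 <= weights s.
Proof.
elim: s => [|w s ih]; first by rewrite /weights big_nil.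
by rewrite weights_cons mulr_ege1// weight_ge1.
Qed.

Lemma weights_gt0 s : 0 < weights s.
Proof. exact: lt_le_trans (weights_ge1 s). Qed.

Lemma sqr_ratio_le4 n : ((n.+2)%:R / n.+1%:R) ^+ 2 <= 4 :> R.
Proof.
have -> : (4 : R) = 2 ^+ 2 by ring.
rewrite ler_sqr ?nnegrE ?divr_ge0 ?ler0n//.
by rewrite ler_pdivrMr ?ltr0n// -natrM ler_nat mul2n -addnn addSn !ltnS leq_addl.
Qed.

Let inv_sqr (i : nat) : R := (i.+1%:R ^+ 2)^-1.

Lemma inv_sqr_ge0 n : 0 <= inv_sqr n. Proof. by rewrite invr_ge0 exprn_ge0. Qed.

Lemma weightE n : (0 < n)%N -> weight n = 64^-1 * growth ^+ n * inv_sqr n.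
Proof. by case: n. Qed.

Lemma weight_le n : weight n <= growth ^+ n * inv_sqr n.
Proof.
case: n => [|n]; first by rewrite /inv_sqr expr0 expr1n invr1 mulr1.
rewrite weightE// -mulrA; set x := _ * inv_sqr _.
have : 0 <= x by rewrite mulr_ge0 ?growthX_ge0 ?inv_sqr_ge0.
lra.
Qed.

Lemma inv_sqr_step n : inv_sqr n <= 4 * inv_sqr n.+1.
Proof.
rewrite /inv_sqr; have := sqr_ratio_le4 n; rewrite expr_div_n => h.
have n2 : (n.+2%:R : R) ^+2 > 0 by rewrite exprn_gt0 ?ltr0n.
by rewrite ler_pdivlMr// mulrC.
Qed.

Lemma inv_sqr_decr n : inv_sqr n.+1 <= inv_sqr n.
Proof.
rewrite lef_pV2 ?posrE ?exprn_gt0 ?ltr0n//.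
by rewrite ler_sqr ?nnegrE ?ler0n// ler_nat.
Qed.

Lemma inv_sqr_add n k : inv_sqr (n + k) <= inv_sqr n.
Proof.
elim: k => [|k ih]; first by rewrite addn0.
by rewrite addnS (le_trans (inv_sqr_decr _)).
Qed.

Lemma weight_step n : weight n <= 4^-1 * weight n.+1.
Proof.
case: n => [|n]; first by rewrite /weight expr1 growthE; lra.
rewrite !weightE// [growth ^+ n.+2]exprS; set a := growth ^+ n.+1.
have a0 : 0 <= a := growthX_ge0 _.
rewrite growthE; have := ler_wpM2l a0 (inv_sqr_step n.+1); have := mulr_ge0 a0 (inv_sqr_ge0 n.+2); lra.
Qed.

Lemma weight_add n k : weight (n + k) <= growth ^+ k * weight n.
Proof.
have k0 := growthX_ge0 k.
have [->|n0] := posnP n.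
  rewrite add0n [weight 0]/= mulr1 (le_trans (weight_le _))// ler_piMr//.
  by rewrite (le_trans (inv_sqr_add 0 k))// /inv_sqr expr1n invr1.
rewrite !weightE ?addn_gt0 ?n0// exprD.
have a0 := growthX_ge0 n.
have := ler_wpM2l (mulr_ge0 k0 a0) (inv_sqr_add n k); lra.
Qed.

Lemma sum_inv_sqr n : \sum_(i < n.+1) inv_sqr i <= 2 - n.+1%:R^-1.
Proof.
elim: n => [|n ih]; first by rewrite big_ord1 /inv_sqr expr1n invr1; lra.
rewrite big_ord_recr/=; apply: (le_trans (lerD ih (lexx _))); rewrite /inv_sqr.
set x : R := n.+1%:R; have -> : (n.+2%:R : R) = x + 1 by rewrite -natr1.
have x0 : 0 < x by rewrite ltr0n.
rewrite -subr_ge0 (_ : _ - _ = (x * (x + 1) ^+ 2)^-1); last first.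
  have x1 : x + 1 != 0 by rewrite gt_eqF ?addr_gt0.
  have x00 : x != 0 by rewrite gt_eqF.
  by clearbody x; field; rewrite x1 x00.
by rewrite invr_ge0 mulr_ge0 ?exprn_ge0 ?addr_ge0 ?ltW.
Qed.

(** With a = i + 1 and b = n - i + 1, the identity
    1 / (a b) = (1 / a + 1 / b) / (a + b) bounds each term by
    2 (a^-2 + b^-2) / (a + b)^2, and the sum of the inverse squares is at
    most 2. *)
Lemma conv_inv_sqr n : \sum_(i < n.+1) inv_sqr i * inv_sqr (n - i) <= 8 * inv_sqr n.+1.
Proof.
have hS k : (k.+1%:R : R) > 0 by rewrite ltr0n.
have h (i : 'I_n.+1) : inv_sqr i * inv_sqr (n - i) <= inv_sqr n.+1 * (2 * inv_sqr i + 2 * inv_sqr (n - i)).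
  rewrite /inv_sqr; set a : R := i.+1%:R; set b : R := (n - i).+1%:R.
  have -> : n.+2%:R = a + b :> R.
    by rewrite -natrD addSn addnS subnKC// -ltnS.
  have a0 : 0 < a by exact: hS.
  have b0 : 0 < b by exact: hS.
  have -> : ((a + b) ^+ 2)^-1 * (2 * (a ^+ 2)^-1 + 2 * (b ^+ 2)^-1) =
      ((a ^+2 * b ^+2)^-1 * ((2 * a ^+ 2 + 2 * b ^+ 2) / (a + b) ^+ 2)).
    have ab : a + b != 0 by rewrite gt_eqF ?addr_gt0.
    have a1 : a != 0 by rewrite gt_eqF.
    have b1 : b != 0 by rewrite gt_eqF.
    by clearbody a b; field; rewrite ?ab ?a1 ?b1.
  have ab0 : 0 <= (a ^+ 2 * b ^+ 2)^-1.
    by rewrite invr_ge0 mulr_ge0 ?exprn_ge0 ?ltW.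
  rewrite -invfM; apply: ler_peMr => //.
  rewrite ler_pdivlMr ?exprn_gt0 ?addr_gt0// mul1r.
  have := sqr_ge0 (a - b); nra.
apply: (le_trans (ler_sum _ (fun i _ => h i))).
rewrite -mulr_sumr big_split/= -!mulr_sumr mulrC.
rewrite ler_wpM2r ?invr_ge0 ?exprn_ge0//.
have -> : \sum_(i < n.+1) inv_sqr (n - i) = \sum_(i < n.+1) inv_sqr i.
  rewrite (reindex_inj rev_ord_inj)/=; apply: eq_bigr => i _.
  by rewrite subSS subKn// -ltnS.
have := sum_inv_sqr n; have : 0 <= (n.+1%:R : R)^-1 by rewrite invr_ge0 ltW.
by move: (_^-1) (\sum_(i < _) _) => y z; lra.
Qed.

(** Total weight of the ways to split a word of length n + 1 at a further
    occurrence of its first letter: the pieces keep the total length, so the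
    gain comes from the constant 64. *)
Lemma conv_weight_same n :
  \sum_(i < n) weight i.+1 * weight (n - i.+1).+1 <= 8^-1 * weight n.+1.
Proof.
have K0 := growthX_ge0.
have h (i : 'I_n) : weight i.+1 * weight (n - i.+1).+1 =
    64^-1 ^+ 2 * growth ^+ n.+1 * (inv_sqr i.+1 * inv_sqr (n - i)).
  have e1 : (n - i.+1).+1 = (n - i)%N by rewrite subnSK.
  have e2 : n.+1 = (i.+1 + (n - i))%N by rewrite addSn subnKC// ltnW.
  by rewrite e1 !weightE ?subn_gt0// e2 exprD; ring.
rewrite (eq_bigr _ (fun i _ => h i)) -mulr_sumr.
have : \sum_(i < n) inv_sqr i.+1 * inv_sqr (n - i) <= 8 * inv_sqr n.+1.
  apply: (@le_trans _ _ (\sum_(i < n.+2) inv_sqr i * inv_sqr (n.+1 - i))).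
    rewrite big_ord_recl big_ord_recr/= -[leLHS]add0r lerD ?mulr_ge0 ?inv_sqr_ge0//.
    by rewrite -[leLHS]addr0 lerD ?mulr_ge0 ?inv_sqr_ge0.
  by apply: (le_trans (conv_inv_sqr _)); rewrite ler_wpM2l// inv_sqr_decr.
rewrite weightE//; set x := \sum_(_ < _) _; have := K0 n.+1.
set a := _ ^+ n.+1; move=> a0 xu; have := ler_wpM2l a0 xu; lra.
Qed.

(** Total weight of the splittings at an occurrence of the inverse of the
    first letter: two letters cancel, so the gain comes from the growth rate,
    which also pays for pieces that are empty. *)
Lemma conv_weight_opp n :
  \sum_(i < n) weight i * weight (n - i.+1) <= 8^-1 * weight n.+1.
Proof.
case: n => [|n]; first by rewrite big_ord0 mulr_ge0 ?invr_ge0 ?ltW// weight_gt0.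
have K0 := growthX_ge0.
have h (i : 'I_n.+1) : weight i * weight (n.+1 - i.+1) <=
    growth ^+ n * (inv_sqr i * inv_sqr (n - i)).
  rewrite subSS; have -> : growth ^+ n = growth ^+ i * growth ^+ (n - i) :> R.
    by rewrite -exprD subnKC// -ltnS.
  rewrite mulrACA ler_pM ?weight_le//; exact/ltW/weight_gt0.
apply: (le_trans (ler_sum _ (fun i _ => h i))).
rewrite -mulr_sumr; apply: le_trans (ler_wpM2l (K0 _) (conv_inv_sqr n)) _.
apply: le_trans (ler_wpM2l (K0 _) (ler_wpM2l _ (inv_sqr_step _))) _ => //.
rewrite weightE// !exprS; set x := inv_sqr _; have := K0 n; set a := _ ^+ n => a0.
rewrite growthE.
have := mulr_ge0 a0 (inv_sqr_ge0 n.+2 : 0 <= x); lra.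
Qed.

End weight.

Section contraction.
Variables (R : realType) (E : Type).
Implicit Types (w : seq E) (s t : seq (seq E)).

(** If |g| <= D W eventually at every sequence, where W is the weight, then the
    approximate recursion improves this to |g| <= (3/4) D W eventually, the
    error being absorbed in the slack between 1/2 and 3/4. Iterating makes the
    bound arbitrarily small; it holds at the start because g is bounded and
    W >= 1. The recursion says nothing about empty words, which are removed
    one at a time. *)
Lemma contraction_cvg0 (I : Type) (F : set_system I) (FF : Filter F)
    (g : I -> seq (seq E) -> R) (C : R) :
  (forall i s, `|g i s| <= C) ->
  (\forall i \near F, g i [::] = 0) ->
  (forall s, \forall i \near F, g i ([::] :: s) = g i s) ->
  (forall e w, exists op : seq (R * seq (seq E)),
     \sum_(x <- op) `|x.1| * weights R x.2 <= 2^-1 * weight R (size w).+1 /\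
     forall t (eps : R), 0 < eps -> \forall i \near F,
       `|g i ((e :: w) :: t) - \sum_(x <- op) x.1 * g i (x.2 ++ t)| <= eps) ->
  forall s (eps : R), 0 < eps -> \forall i \near F, `|g i s| <= eps.
Proof.
move=> gC g0 gnil gop.
pose bnd D := forall s, \forall i \near F, `|g i s| <= D * weights R s.
have step D : 0 < D -> bnd D -> bnd (3 / 4 * D).
  move=> D0 bD; elim=> [|[|e w] t ih].
  - by apply: filterS g0 => i ->; rewrite normr0 mulr_ge0 ?(ltW (weights_gt0 _ _))//; lra.
  - by apply: filterS2 ih (gnil t) => i h ->; rewrite weights_cons mul1r.
  have [op [opw opg]] := gop e w.
  have W0 : 0 < weights R ((e :: w) :: t) by exact: weights_gt0.
  have eps0 : 0 < D / 4 * weights R ((e :: w) :: t) by rewrite mulr_gt0// divr_gt0.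
  have hop : \forall i \near F, `|\sum_(x <- op) x.1 * g i (x.2 ++ t)| <=
      \sum_(x <- op) `|x.1| * (D * weights R (x.2 ++ t)).
    elim: {opw opg} op => [|x op ihop].
      by near=> i; rewrite !big_nil normr0.
    apply: filterS2 ihop (bD (x.2 ++ t)) => i h1 h2.
    rewrite !big_cons (le_trans (ler_normD _ _))// lerD//.
    by rewrite normrM ler_wpM2l.
  apply: filterS2 (opg t _ eps0) hop => i h1 h2.
  rewrite -[g i _](subrK (\sum_(x <- op) x.1 * g i (x.2 ++ t))).
  apply: (le_trans (ler_normD _ _)); apply: (le_trans (lerD h1 h2)).
  have -> : \sum_(x <- op) `|x.1| * (D * weights R (x.2 ++ t)) =
      D * weights R t * \sum_(x <- op) `|x.1| * weights R x.2.
    by rewrite mulr_sumr; apply: eq_bigr => x _; rewrite weights_cat; ring.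
  have Dt : 0 <= D * weights R t by rewrite mulr_ge0 ?ltW ?weights_gt0.
  have := ler_wpM2l Dt opw; rewrite weights_cons [size (_ :: _)]/= => h3.
  apply: (le_trans (lerD (lexx _) h3)); lra.
have iter k : bnd ((3 / 4) ^+ k * (1 + `|C|)).
  elim: k => [|k ih].
    move=> s; near=> i; rewrite expr0 mul1r (le_trans (gC i s))//.
    have C1 : 0 <= 1 + `|C| by rewrite addr_ge0.
    have := ler_peMr C1 (weights_ge1 R s); have := ler_norm C; lra.
    by rewrite exprS -mulrA; apply: step => //; rewrite mulr_gt0 ?exprn_gt0 ?ltr_pwDl ?divr_gt0.
(* The inequality of Bernoulli, to see that (3/4)^k tends to 0. *)
have bern k : 1 + k%:R / 3 <= (4 / 3) ^+ k :> R.
  elim: k => [|k ih]; first by rewrite expr0; lra.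
  rewrite exprS -natr1; have := ler0n R k; nra.
move=> s eps eps0.
have [k hk] : exists k, (3 / 4) ^+ k * (1 + `|C|) * weights R s <= eps.
  set B := (1 + `|C|) * weights R s.
  have B0 : 0 < B by rewrite mulr_gt0 ?weights_gt0// ltr_pwDl.
  exists (Num.bound (3 * (B / eps))).
  set k := Num.bound _; have hk : 3 * (B / eps) < k%:R.
    by rewrite archi_boundP// mulr_ge0// divr_ge0// ltW.
  have -> : (3 / 4 : R) = (4 / 3)^-1 by rewrite invf_div.
  rewrite exprVn -mulrA -/B mulrC ler_pdivrMr ?exprn_gt0 ?divr_gt0//.
  rewrite mulrC -ler_pdivrMr//; apply: le_trans (bern k); lra.
by apply: filterS (iter k s) => i hi; exact: le_trans hi hk.
Unshelve. all: by end_near. Qed.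
End contraction.

(** * The real modulus of a complex number *)

Section complex_modulus.
Context {R : realType}.
Implicit Types z w : R[i].
(** The norm of [R[i]] takes its values in [R[i]]; a real valued modulus gives
    access to the order of [R]. *)
Definition modc z : R := complex.Re `|z|.

Lemma modcE z : (modc z)%:C%C = `|z|.
Proof. by rewrite /modc RRe_real ?normr_real. Qed.

Lemma modc_ge0 z : 0 <= modc z.
Proof. by rewrite -(lecR 0) modcE; exact: normr_ge0. Qed.

Lemma modcD z w : modc (z + w) <= modc z + modc w.
Proof. by rewrite -lecR rmorphD/= !modcE ler_normD. Qed.

Lemma modcM z w : modc (z * w) = modc z * modc w.
Proof. by apply: complexI; rewrite rmorphM/= !modcE normrM. Qed.

Lemma modcN z : modc (- z) = modc z.
Proof. by rewrite /modc normrN. Qed.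

Lemma modcB z w : modc (z - w) <= modc z + modc w.
Proof. by rewrite -(modcN w) modcD. Qed.

Lemma modc0 : modc 0 = 0. Proof. by rewrite /modc normr0. Qed.

Lemma modc1 : modc 1 = 1. Proof. by rewrite /modc normr1. Qed.

Lemma modc_real (x : R) : modc x%:C%C = `|x|.
Proof. by rewrite /modc normc_def/= expr0n/= addr0 sqrtr_sqr. Qed.

Lemma modcX z n : modc (z ^+ n) = modc z ^+ n.
Proof.
by elim: n => [|n ih]; rewrite ?expr0 ?modc1// !exprS modcM ih.
Qed.

Lemma modc_nat n : modc n%:R = n%:R.
Proof. by rewrite /modc normr_nat -[n%:R in LHS](rmorph_nat (real_complex R)). Qed.

Lemma modcV z : modc z^-1 = (modc z)^-1.
Proof. by apply: complexI; rewrite modcE normfV fmorphV/= modcE. Qed.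

Lemma modc_conj z : modc (Num.conj z) = modc z.
Proof. by rewrite /modc norm_conjC. Qed.

Lemma modc_eq0 z : modc z = 0 -> z = 0.
Proof. by move=> z0; apply/eqP; rewrite -normr_eq0 -modcE z0. Qed.

Lemma Re_le_modc z : `|complex.Re z| <= modc z.
Proof.
rewrite /modc normc_def/= -sqrtr_sqr ler_sqrt ?addr_ge0 ?sqr_ge0//.
by rewrite lerDl sqr_ge0.
Qed.

Lemma Im_le_modc z : `|complex.Im z| <= modc z.
Proof.
rewrite /modc normc_def/= -sqrtr_sqr ler_sqrt ?addr_ge0 ?sqr_ge0//.
by rewrite lerDr sqr_ge0.
Qed.

Lemma modc_le z : modc z <= `|complex.Re z| + `|complex.Im z|.
Proof.
rewrite {1}[z]complexE (le_trans (modcD _ _))//= modc_real lerD//.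
by rewrite modcM modc_real /modc normc_def/= expr0n expr1n add0r sqrtr1 mul1r.
Qed.

Lemma modc_sum (I : Type) (r : seq I) (P : pred I) (f : I -> R[i]) :
  modc (\sum_(i <- r | P i) f i) <= \sum_(i <- r | P i) modc (f i).
Proof.
elim/big_ind2 : _ => [|x1 x2 y1 y2 h1 h2|//]; first by rewrite modc0.
by rewrite (le_trans (modcD _ _))// lerD.
Qed.

Lemma complexReM z w : complex.Re (z * w) =
  complex.Re z * complex.Re w - complex.Im z * complex.Im w.
Proof. by case: z => a b; case: w. Qed.

Lemma complexImM z w : complex.Im (z * w) =
  complex.Re z * complex.Im w + complex.Im z * complex.Re w.
Proof. by case: z => a b; case: w. Qed.

Lemma complexReD z w : complex.Re (z + w) = complex.Re z + complex.Re w.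
Proof. by case: z => a b; case: w. Qed.

Lemma complexImD z w : complex.Im (z + w) = complex.Im z + complex.Im w.
Proof. by case: z => a b; case: w. Qed.

End complex_modulus.

(** * Borel structure of SU(N) and translation invariance *)

Section SU_measurability.
Context (R : realType) (N : nat).

Lemma measurable_SU_continuous (f : SU R N -> R) :
  continuous f -> measurable_fun setT f.
Proof.
move=> /continuousP cf; apply: (measurability _ (measurable_realfun.RGenOInfty.measurableE R)).
move=> /= _ [_ [x ->] <-]; rewrite setTI.
by apply: sub_sigma_algebra; apply: cf; exact: interval_open.
Qed.

Lemma suval_continuous : continuous (@suval R N : SU R N -> 'M[R[i]]_N).
Proof. exact: initial_continuous. Qed.

Lemma near_modc (z : R[i]) (e : R) : 0 < e -> \forall w \near z, modc (z - w) < e.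
Proof.
move=> e0; have e0' : 0 < e%:C%C :> R[i] by rewrite ltcR.
have := @cvgr_dist_lt _ R[i] _ (nbhs z) _ id z.
move=> /(_ (nbhs_filter z) (@cvg_id _ _) _ e0').
by apply: filterS => w; rewrite -modcE ltcR.
Qed.

Lemma Re_continuous : continuous (@complex.Re R : R[i] -> R).
Proof.
move=> z A [e /= e0 eA]; apply: filterS (near_modc z e0) => w h; apply: eA.
rewrite /= (_ : - complex.Re w = complex.Re (- w)) -?complexReD; last by case: (w).
exact: le_lt_trans (Re_le_modc _) h.
Qed.

Lemma Im_continuous : continuous (@complex.Im R : R[i] -> R).
Proof.
move=> z A [e /= e0 eA]; apply: filterS (near_modc z e0) => w h; apply: eA.
rewrite /= (_ : - complex.Im w = complex.Im (- w)) -?complexImD; last by case: (w).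
exact: le_lt_trans (Im_le_modc _) h.
Qed.

Lemma entry_continuous i j : continuous (fun M : 'M[R[i]]_N => M i j).
Proof.
move=> M A nA; exists (fun k l => if (k, l) == (i, j) then A else setT).
  by move=> k l /=; case: eqP => [[-> ->]//|_]; exact: filterT.
by move=> B /(_ i j); rewrite eqxx.
Qed.

Lemma suval_entry_continuous i j :
  continuous (fun g : SU R N => suval g i j).
Proof.
move=> g; have := @continuous_comp (SU R N) _ _ (@suval R N) (fun M : 'M[R[i]]_N => M i j) g.
by apply; [exact: suval_continuous|exact: entry_continuous].
Qed.

Lemma measurable_Re_suval i j :
  measurable_fun setT (fun g : SU R N => complex.Re (suval g i j)).
Proof.
apply: measurable_SU_continuous => g.
apply: (@continuous_comp _ _ _ (fun g => suval g i j)); last exact: Re_continuous.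
exact: suval_entry_continuous.
Qed.

Lemma measurable_Im_suval i j :
  measurable_fun setT (fun g : SU R N => complex.Im (suval g i j)).
Proof.
apply: measurable_SU_continuous => g.
apply: (@continuous_comp _ _ _ (fun g => suval g i j)); last exact: Im_continuous.
exact: suval_entry_continuous.
Qed.

Lemma row_mul_continuous (I : Type) (r : seq I) (a : I -> R[i])
    (f : I -> SU R N -> R[i]) :
  (forall k, continuous (f k)) -> continuous (fun x => \sum_(k <- r) a k * f k x).
Proof.
move=> cf x; elim: r => [|k r ih].
  under eq_fun do rewrite big_nil; exact: cst_continuous.
have -> : (fun x => \sum_(j <- k :: r) a j * f j x) =
    (fun x => a k * f k x + \sum_(j <- r) a j * f j x).
  by apply/funext => y; rewrite big_cons.
have h1 := @cvgMl_tmp _ _ (nbhs x) (nbhs_filter x) (f k) (a k) (f k x) (cf k x).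
exact: (@cvgD _ R[i] _ (nbhs x) (nbhs_filter x) _ _ _ _ h1 ih).
Qed.

(** The entries of a product are linear in the entries of the right factor. *)
Lemma SU_mul_continuous (g : SU R N) : continuous (SU_mul g).
Proof.
apply: continuous_comp_initial => h.
move=> A [P Pn PA].
have : \forall x \near h, forall ij : 'I_N * 'I_N,
    P ij.1 ij.2 ((suval g *m suval x) ij.1 ij.2).
  apply: (@filter_forall _ _ (fun ij x => _) (nbhs h) (nbhs_filter h)) => -[i j] /=.
  have := @row_mul_continuous _ (index_enum 'I_N) (suval g i) _
    (fun k => @suval_entry_continuous k j) h.
  have := Pn i j; rewrite mxE => Pij /(_ _ Pij).
  by apply: (@filterS _ (nbhs h) (nbhs_filter h)) => x /=; rewrite mxE.
apply: (@filterS _ (nbhs h) (nbhs_filter h)) => x hx; apply: PA => i j.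
exact: (hx (i, j)).
Qed.

Lemma measurable_SU_mul (g : SU R N) : measurable_fun setT (SU_mul g).
Proof.
apply: (@measurability _ _ _ _ _ _ (@open (SU R N))) => //.
move=> _ [U oU <-]; rewrite setTI; apply: sub_sigma_algebra.
by move/continuousP : (@SU_mul_continuous g); exact.
Qed.

End SU_measurability.

Section translation.
Context (R : realType) (N : nat) (sigma : probability (SU R N) R).
Hypothesis haar : is_haar sigma.

Definition translate n (k : nat) (h : SU R N) (Q : n.-tuple (SU R N)) :
    n.-tuple (SU R N) :=
  [tuple if i == k :> nat then SU_mul h (tnth Q i) else tnth Q i | i < n].

Lemma measurable_translate n k h : measurable_fun setT (@translate n k h).
Proof.
apply/measurable_fun_tnthP => i.
have [ik|ik] := eqVneq (i : nat) k.
  rewrite (_ : _ \o _ = SU_mul h \o (fun Q => tnth Q i)).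
    by apply: measurableT_comp (measurable_SU_mul h) (measurable_tnth i).
  by apply/funext => Q /=; rewrite tnth_mktuple ik eqxx.
rewrite (_ : _ \o _ = (fun Q => tnth Q i)); first exact: measurable_tnth.
by apply/funext => Q /=; rewrite tnth_mktuple (negPf ik).
Qed.

Lemma SU_invP (g : SU R N) :
  (map_mx Num.conj (suval g)^T \is unitarymx) &&
  (\det (map_mx Num.conj (suval g)^T) == 1).
Proof.
case/andP: (suvalP g) => gU /eqP g1.
by rewrite trmxC_unitary gU/= det_map_mx det_tr g1 rmorph1.
Qed.

Definition SU_inv (g : SU R N) : SU R N := MkSU (SU_invP g).

Lemma SU_mulVK (g x : SU R N) : SU_mul g (SU_mul (SU_inv g) x) = x.
Proof.
apply: val_inj => /=; case/andP: (suvalP g) => /unitarymxP gU _.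
by rewrite mulmxA gU mul1mx.
Qed.

(** Invariance is assumed for images; left multiplication is onto, so the
    image of the preimage is the whole set. *)
Lemma haar_preimage h A : measurable A -> sigma (SU_mul h @^-1` A) = sigma A.
Proof.
move=> mA; have mB : measurable (SU_mul h @^-1` A).
  by rewrite -[X in measurable X]setTI; exact: measurable_SU_mul.
rewrite -(haar h mB); congr (sigma _); apply/seteqP; split=> [_ [y Ay <-]//|x Ax].
by exists (SU_mul (SU_inv h) x); rewrite /= ?SU_mulVK.
Qed.

(** Both measures agree on rectangles, which determine the product measure. *)
Lemma product_measure_preserving d1 d2 (T1 : measurableType d1)
    (T2 : measurableType d2) (m1 : probability T1 R) (m2 : probability T2 R)
    (f1 : T1 -> T1) (f2 : T2 -> T2) :
  measurable_fun setT f1 -> measurable_fun setT f2 ->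
  (forall A, measurable A -> m1 (f1 @^-1` A) = m1 A) ->
  (forall A, measurable A -> m2 (f2 @^-1` A) = m2 A) ->
  forall A, measurable A ->
  (m1 \x m2)%E ((fun x => (f1 x.1, f2 x.2)) @^-1` A) = (m1 \x m2)%E A.
Proof.
move=> mf1 mf2 h1 h2 A mA.
pose f x := (f1 x.1, f2 x.2).
have mf : measurable_fun setT f.
  by apply: measurable_fun_pair; apply: measurableT_comp.
apply/esym.
apply: (@product_measure_unique _ _ _ _ _ _ _
  (distribution (m1 \x m2)%E (HB.pack f (isMeasurableFun.Build _ _ _ _ f mf)))) => //.
move=> A1 A2 mA1 mA2; rewrite /distribution /pushforward /=.
have -> : f @^-1` (A1 `*` A2) = (f1 @^-1` A1) `*` (f2 @^-1` A2) by [].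
have mA1' : measurable (f1 @^-1` A1) by rewrite -[f1 @^-1` A1]setTI; exact: mf1.
have mA2' : measurable (f2 @^-1` A2) by rewrite -[f2 @^-1` A2]setTI; exact: mf2.
rewrite product_measure1E//; congr (_ * _)%E; [exact: h1|exact: h2].
Qed.

Lemma translate_tcons n k h (x : SU R N * n.-tuple (SU R N)) :
  translate k h (tcons x) =
  tcons (if k == 0%N then SU_mul h x.1 else x.1,
         if k is k'.+1 then translate k' h x.2 else x.2).
Proof.
apply: eq_from_tnth => i; rewrite tnth_mktuple.
case: (unliftP ord0 i) => [j ->|->]; last by case: k.
rewrite /tcons !tnthS /=; case: k => [|k] //.
by rewrite tnth_mktuple /bump/= add1n eqSS.
Qed.

(** By induction on the number of coordinates: on the product of the first
    factor with the others, the translation acts on one side only. *)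
Lemma power_measure_translate n k h A : measurable A ->
  power_measure sigma n (translate k h @^-1` A) = power_measure sigma n A.
Proof.
elim: n k A => [|n ih] k A mA.
  suff -> : translate k h @^-1` A = A by [].
  by apply/seteqP; split=> Q /=; rewrite (tuple0 (translate k h Q)) (tuple0 Q).
pose mt := @measurable_tcons _ (SU R N) n.
rewrite /= /distribution /pushforward /=.
have -> : @tcons _ (SU R N) n @^-1` (translate k h @^-1` A) =
    (fun x => (if k == 0%N then SU_mul h x.1 else x.1,
     if k is k'.+1 then translate k' h x.2 else x.2)) @^-1` (@tcons _ (SU R N) n @^-1` A).
  by apply/seteqP; split=> x /=; rewrite translate_tcons.
have mA' : measurable (@tcons _ (SU R N) n @^-1` A).
  by rewrite -[X in measurable X]setTI; exact: mt.
case: k => [|k].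
  apply: (@product_measure_preserving _ _ _ _ _ _ (SU_mul h) id) => //.
  - exact: measurable_SU_mul.
  - by move=> B mB; rewrite haar_preimage.
apply: (@product_measure_preserving _ _ _ _ _ _ id (translate k h)) => //.
- exact: measurable_translate.
- exact: ih.
Qed.

End translation.

(** * Integration of bounded complex functions *)

Section cintegral.
Context d (T : measurableType d) (R : realType) (P : probability T R).
Implicit Types f g : T -> R[i].

Definition bounded_measurable f : Prop :=
  [/\ measurable_fun setT (@complex.Re R \o f), measurable_fun setT (@complex.Im R \o f) &
      exists C : R, forall x, modc (f x) <= C].

Definition cintegral f : R[i] :=
  Complex (\int[P]_x complex.Re (f x)) (\int[P]_x complex.Im (f x)).

Lemma bm_cst c : bounded_measurable (fun=> c).
Proof. by split; [exact: measurable_cst|exact: measurable_cst|exists (modc c)]. Qed.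

Lemma bmD f g : bounded_measurable f -> bounded_measurable g ->
  bounded_measurable (fun x => f x + g x).
Proof.
move=> [mf mf' [C hC]] [mg mg' [D hD]]; split.
- rewrite (_ : _ \o _ = (@complex.Re R \o f) \+ (@complex.Re R \o g)).
    exact: measurable_funD.
  by apply/funext => x /=; rewrite complexReD.
- rewrite (_ : _ \o _ = (@complex.Im R \o f) \+ (@complex.Im R \o g)).
    exact: measurable_funD.
  by apply/funext => x /=; rewrite complexImD.
- by exists (C + D) => x; rewrite (le_trans (modcD _ _))// lerD.
Qed.

Lemma bmM f g : bounded_measurable f -> bounded_measurable g ->
  bounded_measurable (fun x => f x * g x).
Proof.
move=> [mf mf' [C hC]] [mg mg' [D hD]]; split.
- rewrite (_ : _ \o _ = ((@complex.Re R \o f) \* (@complex.Re R \o g)) \-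
                        ((@complex.Im R \o f) \* (@complex.Im R \o g))).
    by apply: measurable_funB; exact: measurable_funM.
  by apply/funext => x; exact: complexReM.
- rewrite (_ : _ \o _ = ((@complex.Re R \o f) \* (@complex.Im R \o g)) \+
                        ((@complex.Im R \o f) \* (@complex.Re R \o g))).
    by apply: measurable_funD; exact: measurable_funM.
  by apply/funext => x; exact: complexImM.
- by exists (C * D) => x; rewrite modcM ler_pM ?modc_ge0.
Qed.

Lemma bmZ c f : bounded_measurable f -> bounded_measurable (fun x => c * f x).
Proof. by move=> bf; apply: bmM => //; exact: bm_cst. Qed.

Lemma bmN f : bounded_measurable f -> bounded_measurable (fun x => - f x).
Proof.
by move=> /(bmZ (-1)); congr bounded_measurable; apply/funext => x; rewrite mulN1r.
Qed.

Lemma bmB f g : bounded_measurable f -> bounded_measurable g ->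
  bounded_measurable (fun x => f x - g x).
Proof. by move=> bf /bmN; exact: bmD. Qed.

Lemma bm_sum (I : Type) (r : seq I) (A : pred I) (f : I -> T -> R[i]) :
  (forall i, A i -> bounded_measurable (f i)) ->
  bounded_measurable (fun x => \sum_(i <- r | A i) f i x).
Proof.
move=> bf; elim: r => [|i r ih].
  by under eq_fun do rewrite big_nil; exact: bm_cst.
case Ai: (A i); under eq_fun do rewrite big_cons Ai; last exact: ih.
by apply: bmD => //; exact: bf.
Qed.

Lemma bm_prod (I : Type) (r : seq I) (f : I -> T -> R[i]) :
  (forall i, bounded_measurable (f i)) ->
  bounded_measurable (fun x => \prod_(i <- r) f i x).
Proof.
move=> bf; elim: r => [|i r ih].
  by under eq_fun do rewrite big_nil; exact: bm_cst.
by under eq_fun do rewrite big_cons; exact: bmM.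
Qed.

Lemma bm_conj f : bounded_measurable f ->
  bounded_measurable (fun x => Num.conj (f x)).
Proof.
move=> [mf mf' [C hC]]; split.
- rewrite (_ : _ \o _ = @complex.Re R \o f)//.
  by apply/funext => x /=; case: (f x).
- rewrite (_ : _ \o _ = \- (@complex.Im R \o f)); first exact: measurableT_comp.
  by apply/funext => x /=; case: (f x).
- by exists C => x; rewrite modc_conj.
Qed.

Lemma bm_real (f : T -> R) (C : R) : measurable_fun setT f ->
  (forall x, `|f x| <= C) -> bounded_measurable (fun x => (f x)%:C%C).
Proof.
move=> mf hC; split => //; first exact: measurable_cst.
by exists C => x; rewrite modc_real.
Qed.

Lemma bounded_integrable (f : T -> R) (C : R) : measurable_fun setT f ->
  (forall x, `|f x| <= C) -> P.-integrable setT (EFin \o f).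
Proof.
move=> mf hC; apply: measurable_bounded_integrable => //.
  by apply: (le_lt_trans (probability_le1 P measurableT)); rewrite ltry.
by exists C; split; [exact: num_real|move=> y Cy x _ /=; rewrite (le_trans (hC x))// ltW].
Qed.

Lemma bm_integrable f : bounded_measurable f ->
  P.-integrable setT (EFin \o (@complex.Re R \o f)) /\
  P.-integrable setT (EFin \o (@complex.Im R \o f)).
Proof.
move=> [mf mf' [C hC]]; split; apply: (@bounded_integrable _ C) => // x.
  exact: le_trans (Re_le_modc _) (hC x).
exact: le_trans (Im_le_modc _) (hC x).
Qed.

Lemma cintegralD f g : bounded_measurable f -> bounded_measurable g ->
  cintegral (fun x => f x + g x) = cintegral f + cintegral g.
Proof.
move=> /bm_integrable[f1 f2] /bm_integrable[g1 g2].
apply/eqP; rewrite eq_complex; apply/andP; split; apply/eqP; rewrite /=.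
  by under eq_Rintegral do rewrite complexReD; rewrite RintegralD.
by under eq_Rintegral do rewrite complexImD; rewrite RintegralD.
Qed.

Lemma integrable_scale r (g : T -> R) : P.-integrable setT (EFin \o g) ->
  P.-integrable setT (EFin \o (fun x => r * g x)).
Proof.
move=> ig; rewrite (_ : _ \o _ = (fun x => r%:E * (EFin \o g) x)%E).
  exact: integrableZl.
by apply/funext => x /=; rewrite EFinM.
Qed.

Lemma cintegralZ c f : bounded_measurable f ->
  cintegral (fun x => c * f x) = c * cintegral f.
Proof.
move=> /bm_integrable[f1 f2].
apply/eqP; rewrite eq_complex; apply/andP; split; apply/eqP.
  rewrite complexReM /=; under eq_Rintegral do rewrite complexReM.
  by rewrite RintegralB ?RintegralZl//; exact: integrable_scale.
rewrite complexImM /=; under eq_Rintegral do rewrite complexImM.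
by rewrite RintegralD ?RintegralZl//; exact: integrable_scale.
Qed.

Lemma Rintegral_prob_cst (r : R) : \int[P]_x r = r.
Proof.
rewrite Rintegral_cst// -[RHS]mulr1; congr (_ * _).
exact: (congr1 fine (probability_setT P)).
Qed.

Lemma cintegral_cst c : cintegral (fun=> c) = c.
Proof.
by rewrite /cintegral !Rintegral_prob_cst; case: c.
Qed.

Lemma cintegralN f : bounded_measurable f ->
  cintegral (fun x => - f x) = - cintegral f.
Proof. by move=> bf; under eq_fun do rewrite -mulN1r; rewrite cintegralZ// mulN1r. Qed.

Lemma cintegralB f g : bounded_measurable f -> bounded_measurable g ->
  cintegral (fun x => f x - g x) = cintegral f - cintegral g.
Proof. by move=> bf bg; rewrite cintegralD ?cintegralN//; exact: bmN. Qed.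

Lemma cintegral_sum (I : Type) (r : seq I) (A : pred I) (f : I -> T -> R[i]) :
  (forall i, A i -> bounded_measurable (f i)) ->
  cintegral (fun x => \sum_(i <- r | A i) f i x) = \sum_(i <- r | A i) cintegral (f i).
Proof.
move=> bf; elim: r => [|i r ih].
  by under eq_fun do rewrite big_nil; rewrite cintegral_cst big_nil.
rewrite big_cons; case: ifPn => [|/negPf] Ai; under eq_fun do rewrite big_cons Ai; last exact: ih.
by rewrite cintegralD ?ih//; [exact: bf|exact: bm_sum].
Qed.

(** The factor 2 comes from treating the real and imaginary parts
    separately. *)
Lemma modc_cintegral_le (rho : T -> R) f (C : R) :
  (forall x, 0 <= rho x) -> bounded_measurable (fun x => (rho x)%:C%C) ->
  bounded_measurable f -> (forall x, modc (f x) <= C) ->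
  modc (cintegral (fun x => (rho x)%:C%C * f x)) <= 2 * C * \int[P]_x rho x.
Proof.
move=> rho0 brho bf fC; have brf := bmM brho bf.
have [i1 i2] := bm_integrable brf; have [r1 _] := bm_integrable brho.
rewrite (le_trans (modc_le _))// -mulrA [leRHS]mulrDl mul1r.
have aux (u : T -> R) : P.-integrable setT (EFin \o u) ->
    (forall x, `|u x| <= C * rho x) -> `|\int[P]_x u x| <= C * \int[P]_x rho x.
  move=> iu hu; rewrite (le_trans (le_normr_Rintegral _ _))//.
  rewrite -RintegralZl//; apply: le_Rintegral => //.
    exact: integrable_norm.
  exact: integrable_scale.
have h x : modc ((rho x)%:C%C * f x) <= C * rho x.
  by rewrite modcM modc_real ger0_norm// mulrC ler_wpM2r.
rewrite lerD//; apply: aux => // x.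
  exact: le_trans (Re_le_modc _) (h x).
exact: le_trans (Im_le_modc _) (h x).
Qed.

Lemma modc_cintegral_le1 f (C : R) : bounded_measurable f ->
  (forall x, modc (f x) <= C) -> modc (cintegral f) <= 2 * C.
Proof.
move=> bf fC.
have := @modc_cintegral_le (fun=> 1) f C (fun=> ler01) (bm_cst 1) bf fC.
rewrite Rintegral_prob_cst mulr1.
by under [in modc _]eq_fun do rewrite mul1r.
Qed.

Lemma cintegral_preserving (phi : T -> T) f : measurable_fun setT phi ->
  (forall A, measurable A -> P (phi @^-1` A) = P A) -> bounded_measurable f ->
  bounded_measurable (f \o phi) /\ cintegral (f \o phi) = cintegral f.
Proof.
move=> mphi hP bf; split.
  case: bf => mf mf' [C hC]; split; last by exists C => x; exact: hC.
    exact: (measurableT_comp mf mphi).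
  exact: (measurableT_comp mf' mphi).
have aux (u : T -> R) : measurable_fun setT u -> P.-integrable setT (EFin \o u) ->
    P.-integrable setT (EFin \o (u \o phi)) ->
    \int[P]_x u (phi x) = \int[P]_x u x.
  move=> mu iu iup; rewrite /Rintegral; congr fine.
  have := @integral_pushforward _ _ _ _ R phi mphi P setT (EFin \o u).
  rewrite preimage_setT => <- //; last exact/measurable_EFinP.
  by apply: eq_measure_integral => A mA _; exact: hP.
have [mf mf' [C hC]] := bf.
have h1 x : `|complex.Re (f x)| <= C := le_trans (Re_le_modc _) (hC x).
have h2 x : `|complex.Im (f x)| <= C := le_trans (Im_le_modc _) (hC x).
rewrite /cintegral; congr Complex.
- apply: (aux (@complex.Re R \o f)) => //; first exact: (bounded_integrable mf h1).
  apply: (@bounded_integrable (@complex.Re R \o f \o phi) C) => // [|x]; last exact: h1.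
  exact: measurableT_comp.
- apply: (aux (@complex.Im R \o f)) => //; first exact: (bounded_integrable mf' h2).
  apply: (@bounded_integrable (@complex.Im R \o f \o phi) C) => // [|x]; last exact: h2.
  exact: measurableT_comp.
Qed.
End cintegral.

(** * Differentiation along measure-preserving motions *)

Section flow_derivative.
Context d (T : measurableType d) (R : realType) (P : probability T R).
Variable flow : R -> T -> T.
Implicit Types f g : T -> R[i].
Local Notation bm := (@bounded_measurable _ T R).

(** A derivative at time 0 with a quadratic error that is uniform in the point.
    The uniformity makes differentiation under the integral sign immediate,
    and the curves of motions need not be one-parameter groups. *)
Definition flow_derivative f f' : Prop :=
  [/\ bm f, bm f' &
      exists C : R, forall t x, 0 < t -> t <= 1 ->
        modc (f (flow t x) - f x - t%:C%C * f' x) <= C * t ^+ 2].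

Lemma flow_derivative_cst f : bm f -> (forall t x, f (flow t x) = f x) ->
  flow_derivative f (fun=> 0).
Proof.
move=> bf ff; split => //; first exact: bm_cst.
by exists 0 => t x _ _; rewrite ff subrr mulr0 subr0 modc0 mul0r.
Qed.

Lemma flow_derivativeD f f' g g' : flow_derivative f f' -> flow_derivative g g' ->
  flow_derivative (fun x => f x + g x) (fun x => f' x + g' x).
Proof.
move=> [bf bf' [C hC]] [bg bg' [D hD]]; split; [exact: bmD|exact: bmD|].
exists (C + D) => t x t0 t1; rewrite mulrDl.
rewrite (_ : _ - _ = (f (flow t x) - f x - t%:C%C * f' x) +
                     (g (flow t x) - g x - t%:C%C * g' x)); last by ring.
by rewrite (le_trans (modcD _ _))// lerD ?hC ?hD.
Qed.

(** With r and s the errors for f and g, the error for the product is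
    r g(t) + f s + t^2 f' g' + t f' s. *)
Lemma flow_derivativeM f f' g g' : flow_derivative f f' -> flow_derivative g g' ->
  flow_derivative (fun x => f x * g x) (fun x => f' x * g x + f x * g' x).
Proof.
move=> [bf bf' [C hC]] [bg bg' [D hD]]; split; first exact: bmM.
  by apply: bmD; exact: bmM.
have [_ _ [A hA]] := bf; have [_ _ [A' hA']] := bf'.
have [_ _ [B hB]] := bg; have [_ _ [B' hB']] := bg'.
exists (C * B + A * D + A' * B' + A' * D) => t x t0 t1.
set t' := t%:C%C.
set r := f (flow t x) - f x - t' * f' x; set s := g (flow t x) - g x - t' * g' x.
have -> : f (flow t x) * g (flow t x) - f x * g x - t' * (f' x * g x + f x * g' x) =
    r * g (flow t x) + f x * s + t' * f' x * (t' * g' x) + t' * f' x * s.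
  by rewrite /r /s; ring.
have hr : modc r <= C * t ^+ 2 by exact: hC.
have hs : modc s <= D * t ^+ 2 by exact: hD.
have ht : modc t' = t by rewrite modc_real ger0_norm// ltW.
have t2 : 0 <= t ^+ 2 by rewrite sqr_ge0.
have D0 : 0 <= D * t ^+ 2 := le_trans (modc_ge0 _) hs.
have A'0 : 0 <= A' := le_trans (modc_ge0 _) (hA' x).
have mle (z : R[i]) : 0 <= modc z := modc_ge0 z.
have e1 : modc (r * g (flow t x)) <= C * B * t ^+ 2.
  by rewrite modcM mulrAC ler_pM.
have e2 : modc (f x * s) <= A * D * t ^+ 2 by rewrite modcM -mulrA ler_pM.
have e3 : modc (t' * f' x * (t' * g' x)) <= A' * B' * t ^+ 2.
  rewrite !modcM ht (_ : A' * B' * _ = t * A' * (t * B')); last by ring.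
  by rewrite ler_pM ?mulr_ge0 ?(ltW t0)// ler_wpM2l// ltW.
have e4 : modc (t' * f' x * s) <= A' * D * t ^+ 2.
  rewrite !modcM ht -[A' * D * _]mulrA ler_pM ?mulr_ge0 ?(ltW t0)//.
  by rewrite -[leRHS]mul1r ler_pM ?(ltW t0).
rewrite [leRHS](_ : _ = C * B * t ^+ 2 + A * D * t ^+ 2 + A' * B' * t ^+ 2 +
  A' * D * t ^+ 2); last by ring.
by do 3 (apply: (le_trans (modcD _ _)); apply: lerD => //).
Qed.

Lemma flow_derivativeZ c f f' : flow_derivative f f' ->
  flow_derivative (fun x => c * f x) (fun x => c * f' x).
Proof.
move=> df; have h := flow_derivativeM (flow_derivative_cst (bm_cst T c) (fun _ _ => erefl)) df.
by move: h; under [X in flow_derivative _ X]eq_fun do rewrite mul0r add0r.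
Qed.

Lemma flow_derivative_sum (I : Type) (r : seq I) (F F' : I -> T -> R[i]) :
  (forall i, flow_derivative (F i) (F' i)) ->
  flow_derivative (fun x => \sum_(i <- r) F i x) (fun x => \sum_(i <- r) F' i x).
Proof.
move=> dF; elim: r => [|i r ih].
  under eq_fun do rewrite big_nil; under [X in flow_derivative _ X]eq_fun do rewrite big_nil.
  exact: flow_derivative_cst (bm_cst T 0) _.
under eq_fun do rewrite big_cons; under [X in flow_derivative _ X]eq_fun do rewrite big_cons.
exact: flow_derivativeD.
Qed.

Lemma flow_derivative_conj f f' : flow_derivative f f' ->
  flow_derivative (fun x => Num.conj (f x)) (fun x => Num.conj (f' x)).
Proof.
move=> [bf bf' [C hC]]; split; [exact: bm_conj|exact: bm_conj|].
exists C => t x t0 t1.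
have ct : Num.conj t%:C%C = t%:C%C :> R[i] by apply/CrealP; rewrite complex_real.
rewrite (_ : _ - _ = Num.conj (f (flow t x) - f x - t%:C%C * f' x)).
  by rewrite modc_conj; exact: hC.
rewrite !rmorphB; congr (_ - _); rewrite rmorphM; congr (_ * _); exact/esym/ct.
Qed.

(** From exp u >= 1 + u and exp (- u) >= 1 - u alone. *)
Lemma expR_taylor1 (u : R) : `|expR u - 1 - u| <= u ^+ 2 * expR `|u|.
Proof.
have e1 := expR_ge1Dx u; have e2 := expR_ge1Dx (- u).
have eu0 := expR_gt0 u; have eNu : expR (- u) * expR u = 1.
  by rewrite -expRD addNr expR0.
have h : expR u - 1 <= u * expR u.
  have := ler_wpM2r (ltW eu0) e2; rewrite eNu; lra.
rewrite ger0_norm; last by lra.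
have [u0|u0] := leP 0 u.
  rewrite ger0_norm// expr2 -mulrA; have := ler_wpM2l u0 h; lra.
rewrite ltr0_norm//.
have e3 : 1 <= expR (- u) by lra.
have := ler_wpM2l (sqr_ge0 u) e3; nra.
Qed.

(** S' is allowed to be complex valued, as it is computed from complex traces;
    comparing with the complex number t S' avoids showing that it is real. *)
Lemma flow_derivative_exp (S : T -> R) (S' : T -> R[i]) :
  flow_derivative (fun x => (S x)%:C%C) S' ->
  flow_derivative (fun x => (expR (S x))%:C%C) (fun x => (expR (S x))%:C%C * S' x).
Proof.
move=> [bS bS' [C hC]]; have [mS _ [A hA]] := bS; have [_ _ [A' hA']] := bS'.
have hS x : `|S x| <= A by rewrite -modc_real.
have hexp x : `|expR (S x)| <= expR A.
  by rewrite ger0_norm ?expR_ge0// ler_expR (le_trans (ler_norm _)).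
have bexp : bm (fun x => (expR (S x))%:C%C).
  by apply: (bm_real (C := expR A)) => //; exact: measurableT_comp mS.
split=> //; first exact: bmM.
exists (expR A * ((C + A') ^+ 2 * expR (2 * A) + C)) => t x t0 t1.
set u := S (flow t x) - S x.
have hr : modc (u%:C%C - t%:C%C * S' x) <= C * t ^+ 2.
  by rewrite /u rmorphB; exact: hC.
have C0 : 0 <= C * t ^+ 2 := le_trans (modc_ge0 _) hr.
have A'0 : 0 <= A' := le_trans (modc_ge0 _) (hA' x).
have t2 : t ^+ 2 <= t by rewrite expr2 ler_piMl// ltW.
have C0' : 0 <= C by rewrite -(pmulr_lge0 _ (exprn_gt0 2 t0)).
have hu : `|u| <= (C + A') * t.
  rewrite -modc_real -[u%:C%C](subrK (t%:C%C * S' x)).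
  rewrite (le_trans (modcD _ _))// mulrDl lerD//.
    by rewrite (le_trans hr)// ler_wpM2l.
  by rewrite modcM modc_real ger0_norm ?(ltW t0)// mulrC ler_wpM2r ?(ltW t0).
have hu2 : `|u| <= 2 * A.
  by rewrite /u (le_trans (ler_normB _ _))//; have := hS x; have := hS (flow t x); lra.
have -> : (expR (S (flow t x)))%:C%C - (expR (S x))%:C%C -
    t%:C%C * ((expR (S x))%:C%C * S' x) =
  (expR (S x))%:C%C * ((expR u - 1 - u)%:C%C + (u%:C%C - t%:C%C * S' x)) :> R[i].
  have -> : expR (S (flow t x)) = expR (S x) * expR u.
    by rewrite -expRD /u addrC subrK.
  by rewrite rmorphM/= !rmorphB/=; ring.
rewrite modcM -[leRHS]mulrA ler_pM ?modc_ge0//; first by rewrite modc_real.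
rewrite mulrDl (le_trans (modcD _ _))// lerD// modc_real.
apply: (le_trans (expR_taylor1 u)).
have hu3 : u ^+ 2 <= (C + A') ^+ 2 * t ^+ 2.
  rewrite -exprMn -[u ^+ 2]real_normK ?num_real// ler_sqr// nnegrE//.
  exact: le_trans (normr_ge0 u) hu.
by rewrite [leRHS]mulrAC; apply: ler_pM; rewrite ?sqr_ge0 ?expR_ge0 ?ler_expR.
Qed.

Hypothesis mflow : forall t, measurable_fun setT (flow t).
Hypothesis flowP : forall t A, measurable A -> P (flow t @^-1` A) = P A.

(** The integral of f is unchanged by the motion, so t times the integral of
    f' is O(t^2). *)
Lemma integral_flow_derivative f f' : flow_derivative f f' -> cintegral P f' = 0.
Proof.
move=> [bf bf' [C hC]]; apply: modc_eq0; apply/eqP; rewrite eq_le modc_ge0 andbT.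
apply/ler_addgt0Pl => e e0; rewrite addr0.
have key t : 0 < t -> t <= 1 -> modc (cintegral P f') <= 2 * C * t.
  move=> t0 t1; rewrite -(ler_pM2l t0).
  have [bft ft] := cintegral_preserving (mflow t) (flowP t) bf.
  have -> : t * modc (cintegral P f') = modc (cintegral P (fun x =>
      f (flow t x) - f x - t%:C%C * f' x)).
    rewrite cintegralB ?cintegralB ?cintegralZ//; last 2 first.
    - exact: bmB.
    - exact: bmZ.
    by rewrite ft subrr sub0r modcN modcM modc_real gtr0_norm.
  rewrite (_ : t * (2 * C * t) = 2 * (C * t ^+ 2)); last by ring.
  apply: modc_cintegral_le1 => [|x]; last exact: hC.
  by apply: bmB; [exact: bmB|exact: bmZ].
have C1 : 0 < 2 * `|C| + 1 by rewrite ltr_wpDl ?mulr_ge0.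
pose t := Num.min 1 (e / (2 * `|C| + 1)).
have t0 : 0 < t by rewrite lt_min ltr01 divr_gt0.
have t1 : t <= 1 by rewrite ge_min lexx.
apply: (le_trans (key t t0 t1)).
have te : t * (2 * `|C| + 1) <= e by rewrite -ler_pdivlMr// ge_min lexx orbT.
apply: le_trans te; rewrite mulrC ler_wpM2l ?ltW//.
by have := ler_norm C; lra.
Qed.

End flow_derivative.

(** * Curves in SU(N) through the identity *)

Section SU_curves.
Context (R : realType) (N : nat).
Implicit Types X V : 'M[R[i]]_N.
Local Notation adj X := (map_mx Num.conj X^T).

Lemma adjM X V : adj (X *m V) = adj V *m adj X.
Proof. by rewrite trmx_mul map_mxM. Qed.

Lemma adjD X V : adj (X + V) = adj X + adj V.
Proof. by rewrite linearD/= map_mxD. Qed.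

Lemma conj_realC (x : R) : Num.conj x%:C%C = x%:C%C.
Proof. by apply/CrealP; rewrite complex_real. Qed.

Lemma adjZ (a : R[i]) X : adj (a *: X) = Num.conj a *: adj X.
Proof. by rewrite linearZ/= map_mxZ. Qed.

Lemma adjN X : adj (- X) = - adj X.
Proof. by apply/matrixP => i j; rewrite !mxE rmorphN. Qed.

Lemma adj1 : adj (1%:M : 'M[R[i]]_N) = 1%:M.
Proof. by rewrite trmx1 map_mx1. Qed.

(** X is the velocity at the identity of a curve in SU(N), with a quadratic
    error. Both this and skew-Hermitianness enter the variation of the edge
    variables and of their inverses. *)
Definition SU_velocity X : Prop :=
  adj X = - X /\
  exists (h : R -> SU R N) (C : R), forall t i j, 0 < t -> t <= 1 ->
    modc ((suval (h t) - 1%:M - t%:C%C *: X) i j) <= C * t ^+ 2.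

(** For X^3 = - X this is exp (theta X), where c = cos theta and s = sin theta
    (the formula of Rodrigues). *)
Let rot (c s : R) X := 1%:M + s%:C%C *: X + (1 - c)%:C%C *: (X *m X).

(** The multiplication table of the span of 1, X and X^2 when X^3 = - X. *)
Lemma mul_quadratic (a b a' b' : R) X : X *m X *m X = - X ->
  (1%:M + a%:C%C *: X + b%:C%C *: (X *m X)) *m
  (1%:M + a'%:C%C *: X + b'%:C%C *: (X *m X)) =
  1%:M + (a + a' - a * b' - b * a')%:C%C *: X +
  (b + b' + a * a' - b * b')%:C%C *: (X *m X).
Proof.
move=> X3; have X4 : X *m X *m (X *m X) = - (X *m X).
  by rewrite mulmxA X3 mulNmx.
have X3' : X *m (X *m X) = - X by rewrite mulmxA.
rewrite !mulmxDl !mulmxDr !mul1mx !mulmx1 -!scalemxAl -!scalemxAr X3 X3' X4.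
rewrite !scalerN !scalerA -!rmorphM/= !rmorphB !rmorphD/=.
rewrite !scalerBl !scalerDl.
apply/matrixP => i j; rewrite !mxE; ring.
Qed.

(** Let U be the rotation [rot c s X], which is unitary. Since V anticommutes
    with X it conjugates U to its adjoint, so det U is its own inverse and U^2
    has determinant 1. The angle is parametrized rationally by
    c = (1 - t^2) / (1 + t^2) and s = 2 t / (1 + t^2), so U^2 is
    1 + 4 t X + O(t^2). *)
Lemma rotation_velocity X V : adj X = - X -> X *m X *m X = - X ->
  V \in unitmx -> V *m X = - (X *m V) -> SU_velocity (4 *: X).
Proof.
move=> aX X3 Vu VX.
have adj_rot c s : adj (rot c s X) = rot c (- s) X.
  rewrite /rot !adjD !adjZ adjM aX adj1 !conj_realC mulNmx mulmxN opprK.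
  by rewrite scalerN rmorphN scaleNr.
have rot_adj c s : c ^+ 2 + s ^+ 2 = 1 -> rot c s X *m adj (rot c s X) = 1%:M.
  move=> cs; rewrite adj_rot mul_quadratic//.
  rewrite (_ : s + _ - _ - _ = 0); last by ring.
  rewrite (_ : 1 - c + _ + _ - _ = 1 - (c ^+ 2 + s ^+ 2)); last by ring.
  by rewrite cs subrr !scale0r !addr0.
have VX2 : V *m (X *m X) = X *m X *m V.
  by rewrite mulmxA VX mulNmx -[X *m V *m X]mulmxA VX mulmxN opprK mulmxA.
(* V U V^-1 is the adjoint of U. *)
have V_rot c s : V *m rot c s X = adj (rot c s X) *m V.
  rewrite adj_rot /rot !mulmxDr !mulmxDl mulmx1 mul1mx -!scalemxAr -!scalemxAl.
  by rewrite VX VX2 scalerN rmorphN scaleNr.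
have det_rot c s : c ^+ 2 + s ^+ 2 = 1 -> \det (rot c s X) * \det (rot c s X) = 1.
  move=> cs; have /(congr1 determinant) := V_rot c s.
  have dV : \det V != 0 by rewrite -unitfE -unitmxE.
  rewrite !det_mulmx mulrC => /(mulIf dV) h.
  by rewrite {2}h -det_mulmx rot_adj// det1.
(* Rational parametrization of the circle. *)
pose c (t : R) := (1 - t ^+ 2) / (1 + t ^+ 2).
pose s (t : R) := 2 * t / (1 + t ^+ 2).
have t2 t : 1 + t ^+ 2 != 0 :> R by rewrite gt_eqF// ltr_pwDl// sqr_ge0.
have cs t : c t ^+ 2 + s t ^+ 2 = 1.
  by rewrite /c /s; field; exact: t2.
pose U t := rot (c t) (s t) X.
have hP t : (U t *m U t \is unitarymx) && (\det (U t *m U t) == 1).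
  rewrite det_mulmx det_rot// eqxx andbT mul_unitarymx//; apply/unitarymxP; exact: rot_adj.
split; first by rewrite adjZ aX scalerN conjC_nat.
pose B := \sum_i \sum_j (modc (X i j) + modc ((X *m X) i j)).
exists (fun t => MkSU (hP t)), (28 * B) => t i j t0 t1.
have hB : modc (X i j) + modc ((X *m X) i j) <= B.
  rewrite /B (bigD1 i)//= (bigD1 j)//= -addrA lerDl addr_ge0//.
    by apply: sumr_ge0 => k _; rewrite addr_ge0 ?modc_ge0.
  by apply: sumr_ge0 => k _; apply: sumr_ge0 => l _; rewrite addr_ge0 ?modc_ge0.
rewrite /= /U /rot mul_quadratic//.
set a := _ + s t - _ - _; set b := 1 - c t + _ + _ - _.
have tge0 := ltW t0.
have t4 : t ^+ 2 <= 1 by rewrite expr_le1.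
have t20 := sqr_ge0 t.
have ha : `|a - 4 * t| <= 28 * t ^+ 2.
  have -> : a - 4 * t = - (4 * t ^+ 3 * ((3 + t ^+ 2) / (1 + t ^+ 2) ^+ 2)).
    by rewrite /a /c /s; field; exact: t2.
  have q0 : 0 <= (3 + t ^+ 2) / (1 + t ^+ 2) ^+ 2.
    by rewrite divr_ge0 ?exprn_ge0 ?addr_ge0 ?ler0n.
  have q4 : (3 + t ^+ 2) / (1 + t ^+ 2) ^+ 2 <= 4.
    rewrite ler_pdivrMr ?exprn_gt0 ?ltr_pwDl//; nra.
  have t30 : 0 <= 4 * t ^+ 3 by rewrite mulr_ge0 ?exprn_ge0 ?ltW.
  rewrite normrN ger0_norm; last exact: mulr_ge0.
  apply: (le_trans (ler_wpM2l t30 q4)); rewrite exprS; nra.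
have hb : `|b| <= 28 * t ^+ 2.
  have -> : b = t ^+ 2 * (8 / (1 + t ^+ 2) ^+ 2).
    by rewrite /b /c /s; field; exact: t2.
  have q0 : 0 <= 8 / (1 + t ^+ 2) ^+ 2.
    by rewrite divr_ge0 ?exprn_ge0 ?addr_ge0 ?ler0n.
  have q4 : 8 / (1 + t ^+ 2) ^+ 2 <= 28.
    rewrite ler_pdivrMr ?exprn_gt0 ?ltr_pwDl//; nra.
  by rewrite ger0_norm; [rewrite mulrC ler_wpM2r|exact: mulr_ge0].
move: a b ha hb => a b ha hb.
rewrite (_ : _ i j = (a - 4 * t)%:C%C * X i j + b%:C%C * (X *m X) i j); last first.
  have -> : (4 : R[i]) = (4 : R)%:C%C by rewrite rmorph_nat.
  rewrite !mxE rmorphB rmorphM/=.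
  move: (\sum_(_ < _) _) (X i j) a%:C%C b%:C%C t%:C%C 4%:C%C => y x a' b' t' k.
  ring.
rewrite (le_trans (modcD _ _))// !modcM !modc_real mulrAC.
apply: (@le_trans _ _ (28 * t ^+ 2 * (modc (X i j) + modc ((X *m X) i j)))).
  by rewrite mulrDr lerD// ler_wpM2r// modc_ge0.
by rewrite ler_wpM2l// mulr_ge0.
Qed.

Lemma adj_delta (j k : 'I_N) : adj (delta_mx j k : 'M[R[i]]_N) = delta_mx k j.
Proof. by rewrite trmx_delta map_delta_mx. Qed.

End SU_curves.

Section elementary_velocities.
Context (R : realType) (N : nat).
Implicit Types X V D : 'M[R[i]]_N.
Local Notation adj X := (map_mx Num.conj X^T).

(** For a projection D, 1 - 2 D is a reflection; it reverses X when X
    exchanges the image and the kernel of D. *)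
Lemma reflection_anticommute D X : D *m D = D -> X = D *m X + X *m D ->
  let V := 1%:M - (D + D) in V \in unitmx /\ V *m X = - (X *m V).
Proof.
move=> DD XE V.
have VV : V *m V = 1%:M.
  rewrite /V mulmxBl !mulmxBr !mul1mx !mulmx1 !mulmxDl !mulmxDr !DD.
  by apply/matrixP => i j; rewrite !mxE; move: (D i j) => x; ring.
split; first by case: (mulmx1_unit VV).
rewrite /V mulmxBl mulmxBr mul1mx mulmx1 mulmxDl mulmxDr.
move: XE; move: (D *m X) (X *m D) => A B ->.
by apply/matrixP => i j; rewrite !mxE; ring.
Qed.

(** The reflection of the j-th basis vector reverses this rotation of the
    (j, k) plane. *)
Lemma velocity_offdiag (w : R[i]) (j k : 'I_N) : j != k -> w * Num.conj w = 1 ->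
  SU_velocity (4 *: (w *: delta_mx j k - Num.conj w *: delta_mx k j)).
Proof.
move=> jk ww; have kj : k != j by rewrite eq_sym.
set A : 'M[R[i]]_N := delta_mx j k; set B : 'M[R[i]]_N := delta_mx k j.
set X := _ - _.
have AA : A *m A = 0 by rewrite mul_delta_mx_0.
have BB : B *m B = 0 by rewrite mul_delta_mx_0.
have AB : A *m B = delta_mx j j by rewrite mul_delta_mx.
have BA : B *m A = delta_mx k k by rewrite mul_delta_mx.
have X2 : X *m X = - (delta_mx j j + delta_mx k k).
  rewrite /X !mulmxBl !mulmxBr -!scalemxAl -!scalemxAr AA BB AB BA.
  by rewrite !scaler0 !scalerA [Num.conj w * w]mulrC ww !scale1r subr0 sub0r opprD.
have DA : delta_mx j j *m A = A by rewrite mul_delta_mx.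
have AD : A *m delta_mx j j = 0 by rewrite mul_delta_mx_0.
have DB : delta_mx j j *m B = 0 by rewrite mul_delta_mx_0.
have BD : B *m delta_mx j j = B by rewrite mul_delta_mx.
have DD : delta_mx j j *m delta_mx j j = delta_mx j j :> 'M[R[i]]_N.
  by rewrite mul_delta_mx.
have XE : X = delta_mx j j *m X + X *m delta_mx j j.
  rewrite /X mulmxBl mulmxBr -!scalemxAl -!scalemxAr DA AD DB BD.
  by rewrite !scaler0 subr0 sub0r.
have [Vu VX] := reflection_anticommute DD XE.
apply: (rotation_velocity _ _ Vu VX).
- by rewrite /X adjD adjN !adjZ !adj_delta conjCK opprB.
- rewrite X2 mulNmx /X; congr (- _).
  have KA : delta_mx k k *m A = 0 by rewrite mul_delta_mx_0.
  have KB : delta_mx k k *m B = B by rewrite mul_delta_mx.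
  by rewrite mulmxBr !mulmxDl -!scalemxAr DA DB KA KB !scaler0 addr0 add0r.
Qed.

(** Here the transposition of the two basis vectors reverses the direction. *)
Lemma velocity_diag (j k : 'I_N) : j != k ->
  SU_velocity (4 *: (('i : R[i]) *: (delta_mx j j - delta_mx k k))).
Proof.
move=> jk; have kj : k != j by rewrite eq_sym.
set A : 'M[R[i]]_N := delta_mx j j; set B : 'M[R[i]]_N := delta_mx k k.
have AA : A *m A = A by rewrite mul_delta_mx.
have BB : B *m B = B by rewrite mul_delta_mx.
have AB : A *m B = 0 by rewrite mul_delta_mx_0.
have BA : B *m A = 0 by rewrite mul_delta_mx_0.
set X := 'i *: _.
have XX : X *m X = - (A + B).
  rewrite /X -scalemxAl -scalemxAr scalerA -expr2 sqrCi scaleN1r.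
  by rewrite mulmxBl !mulmxBr AA AB BA BB subr0 sub0r opprK.
apply: (@rotation_velocity _ _ X (tperm_mx j k)).
- rewrite /X adjZ adjD adjN !adj_delta conjCi scaleNr.
  by [].
- rewrite XX mulNmx /X -scalemxAr; congr (- (_ *: _)).
  by rewrite mulmxBr !mulmxDl AA AB BA BB addr0 add0r.
- exact: unitmx_perm.
- rewrite /X -scalemxAr -scalemxAl -scalerN; congr (_ *: _).
  rewrite mulmxBr mulmxBl opprB.
  have h (l : 'I_N) : tperm_mx j k *m delta_mx l l = delta_mx (tperm j k l) (tperm j k l) *m tperm_mx j k :> 'M[R[i]]_N.
    have e : tperm_mx j k = perm_mx (tperm j k)^-1%g :> 'M[R[i]]_N by rewrite tpermV.
    rewrite [X in _ = _ *m X]e -row_permE -col_permE.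
    apply/matrixP => a b; rewrite !mxE.
    by rewrite -(inj_eq (@perm_inj _ (tperm j k)) a) tpermK (inj_eq perm_inj).
  by rewrite /A /B !h tpermL tpermR.
Qed.
End elementary_velocities.

(** * Edges and words *)

Section words.
Variable d : nat.
Implicit Types (e f a : edge d) (w : seq (edge d)).

Lemma einvK : involutive (@einv d). Proof. by case. Qed.

(** The occurrences of e (tagged [false]) and of its inverse (tagged [true]) in
    w, each with the parts of w before and after the letter. *)
Fixpoint occ e w : seq (bool * (seq (edge d) * seq (edge d))) :=
  if w is f :: w' then
    (if f == e then [:: (false, ([::], w'))]
     else if f == einv e then [:: (true, ([::], w'))] else [::]) ++
    [seq (o.1, (f :: o.2.1, o.2.2)) | o <- occ e w']
  else [::].

Lemma occ_cons e f w : occ e (f :: w) =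
    (if f == e then [:: (false, ([::], w))]
     else if f == einv e then [:: (true, ([::], w))] else [::]) ++
    [seq (o.1, (f :: o.2.1, o.2.2)) | o <- occ e w].
Proof. by []. Qed.

Lemma occ_rcons e w f : occ e (rcons w f) =
    [seq (o.1, (o.2.1, rcons o.2.2 f)) | o <- occ e w] ++
    (if f == e then [:: (false, (w, [::]))]
     else if f == einv e then [:: (true, (w, [::]))] else [::]).
Proof.
elim: w => [|g w ih]; first by rewrite /= cats0.
rewrite rcons_cons !occ_cons ih !map_cat -!map_comp -catA; congr (_ ++ (_ ++ _)).
  by case: ifP => //; case: ifP.
by case: ifP => //; case: ifP.
Qed.

Lemma occ_einv e w : e != einv e ->
  occ (einv e) w = [seq (~~ o.1, o.2) | o <- occ e w].
Proof.
move=> ee; elim: w => [//|f w ih]; rewrite !occ_cons ih map_cat -!map_comp einvK.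
congr (_ ++ _); have [->|fe] := eqVneq f e; first by rewrite (negPf ee).
by case: ifP.
Qed.

Lemma size_occ e w : (size (occ e w) <= size w)%N.
Proof.
elim: w => [//|f w ih]; rewrite occ_cons size_cat size_map.
by case: ifP => _; [|case: ifP => _]; rewrite /= ?add1n ?add0n ?ltnS// ltnW.
Qed.

Lemma size_occP e w o : o \in occ e w -> (size o.2.1 + size o.2.2).+1 = size w.
Proof.
elim: w o => [//|f w ih] o; rewrite occ_cons mem_cat => /orP[|].
  by case: ifP => _; [|case: ifP => _]; rewrite ?inE// => /eqP ->.
by move=> /mapP[x xo ->] /=; rewrite addSn (ih _ xo).
Qed.

Lemma occ_nil e w : e \notin w -> einv e \notin w -> occ e w = [::].
Proof.
elim: w => [//|f w ih]; rewrite !inE !negb_or => /andP[ef ew] /andP[ef' ew'].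
by rewrite occ_cons ih// eq_sym (negPf ef) eq_sym (negPf ef').
Qed.

Definition word_inv w := rev (map (@einv d) w).

Lemma nn_einv e : nn (einv e) = nn e.
Proof. by rewrite /nn /=; under eq_bigr do rewrite distrC. Qed.

Lemma nn_neq e : nn e -> e.1 != e.2.
Proof.
apply: contraTneq => ee; rewrite /nn ee big1// => i _.
by rewrite subrr normr0.
Qed.

Lemma epos_einv e : nn e -> epos (einv e) = ~~ epos e.
Proof.
move=> /nn_neq ne; rewrite /epos /vlt /= -leNgt.
rewrite (@lt_neqAle _ (d.-tuplelexi int)).
by rewrite eq_sym (_ : _ == _ = false)// (negPf ne).
Qed.

Lemma einv_neq e : nn e -> e != einv e.
Proof.
move=> /nn_neq; apply: contraNneq; case: e => x y [/= -> _] //.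
Qed.

Variable L : {fset vertex d}.

Lemma in_edges e : (e \in edges L) = [&& e.1 \in L, e.2 \in L & nn e].
Proof. by rewrite !inE /= andbA. Qed.

Lemma in_pos_edges e : (e \in pos_edges L) = (e \in edges L) && epos e.
Proof. by rewrite !inE. Qed.

Lemma edges_einv e : (einv e \in edges L) = (e \in edges L).
Proof. by rewrite !in_edges nn_einv /= andbCA. Qed.

Lemma pos_edges_einv e : e \in pos_edges L -> einv e \notin pos_edges L.
Proof.
rewrite !in_pos_edges edges_einv => /andP[eL ep]; rewrite eL/=.
by move: eL; rewrite in_edges => /and3P[_ _ /epos_einv ->]; rewrite ep.
Qed.

Lemma edges_pos e : e \in edges L -> e \in pos_edges L \/ einv e \in pos_edges L.
Proof.
move=> eL; rewrite !in_pos_edges edges_einv eL.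
by move: eL; rewrite in_edges => /and3P[_ _ /epos_einv ->]; case: epos; [left|right].
Qed.

End words.

(** * Traces of holonomies and their first variation *)

Section unitary.
Context (R : realType) (N : nat).
Implicit Types U : 'M[R[i]]_N.
Local Notation adj X := (map_mx Num.conj X^T).

Lemma unitary_entry_le1 U i j : U \is unitarymx -> modc (U i j) <= 1.
Proof.
move=> /unitarymxP /matrixP /(_ i i); rewrite !mxE eqxx => h.
have h1 : \sum_k modc (U i k) ^+ 2 = 1.
  apply: complexI; rewrite rmorph_sum rmorph1 -[RHS]h; apply: eq_bigr => k _.
  by rewrite !mxE rmorphXn/= modcE normCK.
rewrite -(@expr_le1 _ 2) ?modc_ge0// -h1 (bigD1 j)//= lerDl.
by apply: sumr_ge0 => k _; rewrite sqr_ge0.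
Qed.

Lemma unitary_trace_le U : U \is unitarymx -> modc (\tr U) <= N%:R.
Proof.
move=> Uu; rewrite /mxtrace (le_trans (modc_sum _ _ _))//.
rewrite (le_trans (ler_sum _ (fun i _ => unitary_entry_le1 i i Uu)))//.
by rewrite sumr_const card_ord.
Qed.

(** Inserting a matrix unit E_jk in a product and reading off the (j, k) entry
    cuts the trace in two: this produces the splittings. *)
Lemma sum_trace_delta (A B : 'M[R[i]]_N) :
  \sum_j \sum_k (A *m delta_mx j k *m B) j k = \tr A * \tr B.
Proof.
rewrite /mxtrace mulr_suml; apply: eq_bigr => j _; rewrite mulr_sumr.
apply: eq_bigr => k _; rewrite mxE (bigD1 k)//= big1 ?addr0.
  rewrite mxE (bigD1 j)//= big1 ?addr0 ?mxE ?eqxx ?mulr1//.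
  by move=> l lj; rewrite mxE (negPf lj) mulr0.
move=> l lk; rewrite mxE big1 ?mul0r// => m _.
by rewrite mxE (negPf lk) andbF mulr0.
Qed.

Lemma trace_delta (A B : 'M[R[i]]_N) j k :
  \tr (A *m delta_mx j k *m B) = (B *m A) k j.
Proof.
rewrite mxtrace_mulC mulmxA; move: (B *m A) => C.
rewrite /mxtrace (bigD1 k)//= big1 ?addr0.
  rewrite mxE (bigD1 j)//= big1 ?addr0 ?mxE ?eqxx ?mulr1//.
  by move=> l lj; rewrite mxE (negPf lj) mulr0.
move=> l lk; rewrite mxE big1// => m _.
by rewrite mxE (negPf lk) andbF mulr0.
Qed.

(** Inserting E_jk in a trace and pairing with the (j, k) entry of another
    matrix joins the two: this produces the mergers and deformations. *)
Lemma sum_entry_trace_delta (W A B : 'M[R[i]]_N) :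
  \sum_j \sum_k W j k * \tr (A *m delta_mx j k *m B) = \tr (W *m B *m A).
Proof.
rewrite -[W *m B *m A]mulmxA [RHS]/mxtrace; apply: eq_bigr => j _; rewrite mxE.
by apply: eq_bigr => k _; rewrite trace_delta.
Qed.

End unitary.

Section holonomy.
Context (R : realType) (N d : nat) (L : {fset vertex d}).
Local Notation adj X := (map_mx Num.conj X^T).
Implicit Types (Q : config R N L) (e f a : edge d) (w p q : seq (edge d)).

Lemma adjK (X : 'M[R[i]]_N) : adj (adj X) = X.
Proof. exact: trmxCK. Qed.

Lemma edge_mx_einv Q f : edge_mx Q (einv f) = adj (edge_mx Q f).
Proof.
rewrite /edge_mx; rewrite einvK.
have [fp|fn] := boolP (f \in pos_edges L).
  by rewrite (negPf (pos_edges_einv fp)).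
by case: (einv f \in _); rewrite ?adjK ?adj1.
Qed.

Lemma edge_mx_unitary Q f : edge_mx Q f \is unitarymx.
Proof.
rewrite /edge_mx; case: ifPn => [fp|fn].
  by case/andP: (suvalP (nth (SU1 R N) Q (index f (pos_edges L)))).
case: ifPn => _; last by apply/unitarymxP; rewrite adj1 mulmx1.
rewrite trmxC_unitary.
by case/andP: (suvalP (nth (SU1 R N) Q (index (einv f) (pos_edges L)))).
Qed.

Lemma path_mx_nil Q : path_mx Q [::] = 1%:M.
Proof. by rewrite /path_mx big_nil. Qed.

Lemma path_mx_cons Q f w : path_mx Q (f :: w) = edge_mx Q f *m path_mx Q w.
Proof. by rewrite /path_mx big_cons mulmxE. Qed.

Lemma path_mx1 Q f : path_mx Q [:: f] = edge_mx Q f.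
Proof. by rewrite path_mx_cons path_mx_nil mulmx1. Qed.

Lemma path_mx_rcons Q f w : path_mx Q (rcons w f) = path_mx Q w *m edge_mx Q f.
Proof. by rewrite -cats1 path_mx_cat path_mx1. Qed.

Lemma path_mx_unitary Q w : path_mx Q w \is unitarymx.
Proof.
elim: w => [|f w ih]; last by rewrite path_mx_cons mul_unitarymx ?edge_mx_unitary.
by rewrite path_mx_nil; apply/unitarymxP; rewrite adj1 mulmx1.
Qed.

Lemma edge_mxV Q f : edge_mx Q f *m edge_mx Q (einv f) = 1%:M.
Proof. by rewrite edge_mx_einv; apply/unitarymxP/edge_mx_unitary. Qed.

Lemma edge_mxVl Q f : edge_mx Q (einv f) *m edge_mx Q f = 1%:M.
Proof. by rewrite -{2}[f]einvK edge_mxV. Qed.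

Lemma path_mx_inv Q w : path_mx Q (word_inv w) = adj (path_mx Q w).
Proof.
elim: w => [|f w ih]; first by rewrite /word_inv path_mx_nil adj1.
by rewrite /word_inv map_cons rev_cons path_mx_rcons ih path_mx_cons adjM edge_mx_einv.
Qed.

Definition htrace Q w : R[i] := \tr (path_mx Q w).

Lemma htrace_cat Q u v : htrace Q (u ++ v) = htrace Q (v ++ u).
Proof. by rewrite /htrace !path_mx_cat mxtrace_mulC. Qed.

(** By cyclicity of the trace the two outer letters meet and cancel. *)
Lemma htrace_conjugate Q f w : htrace Q (f :: rcons w (einv f)) = htrace Q w.
Proof.
rewrite /htrace path_mx_cons path_mx_rcons mulmxA mxtrace_mulC mulmxA.
by rewrite edge_mxVl mul1mx.
Qed.

Lemma htrace_nil Q : htrace Q [::] = N%:R.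
Proof. by rewrite /htrace path_mx_nil mxtrace1. Qed.

Lemma htrace_inv Q w : htrace Q (word_inv w) = Num.conj (htrace Q w).
Proof. by rewrite /htrace path_mx_inv trace_map_mx mxtrace_tr. Qed.

Lemma modc_htrace Q w : modc (htrace Q w) <= N%:R.
Proof. exact/unitary_trace_le/path_mx_unitary. Qed.

Definition htraces Q (t : seq (seq (edge d))) : R[i] := \prod_(w <- t) htrace Q w.

Lemma htraces_cons Q w t : htraces Q (w :: t) = htrace Q w * htraces Q t.
Proof. by rewrite /htraces big_cons. Qed.

Lemma modc_htraces Q t : modc (htraces Q t) <= N%:R ^+ size t.
Proof.
elim: t => [|w t ih]; first by rewrite /htraces big_nil modc1 expr0.
by rewrite htraces_cons modcM exprS ler_pM ?modc_ge0 ?modc_htrace.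
Qed.

Variable a : edge d.

(** The effect on a word of moving Q_a to (1 + t X) Q_a, at one occurrence: X
    enters before a letter a, and - X after a letter a^-1, because the adjoint
    of X is - X. *)
Definition edge_insert Q (X : 'M[R[i]]_N) (o : bool * (seq (edge d) * seq (edge d))) :=
  if o.1 then - (path_mx Q (rcons o.2.1 (einv a)) *m X *m path_mx Q o.2.2)
  else path_mx Q o.2.1 *m X *m path_mx Q (a :: o.2.2).

(** Written as a sum over insertions, so that it is linear in X and makes sense
    for every complex matrix X, not only for skew-Hermitian ones. *)
Definition dpath Q X w : 'M[R[i]]_N := \sum_(o <- occ a w) edge_insert Q X o.

Definition dedge Q X f : 'M[R[i]]_N :=
  if f == a then X *m edge_mx Q f
  else if f == einv a then - (edge_mx Q f *m X) else 0.

Lemma dpath_nil Q X : dpath Q X [::] = 0.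
Proof. by rewrite /dpath big_nil. Qed.

Lemma dpath_cons Q X f w :
  dpath Q X (f :: w) = dedge Q X f *m path_mx Q w + edge_mx Q f *m dpath Q X w.
Proof.
rewrite /dpath occ_cons big_cat/=; congr (_ + _).
  rewrite /dedge; case: eqP => [->|_].
    by rewrite big_seq1 /edge_insert/= path_mx_nil mul1mx path_mx_cons mulmxA.
  case: eqP => [->|_]; last by rewrite big_nil mul0mx.
  by rewrite big_seq1 /edge_insert/= path_mx1 mulNmx.
rewrite big_map mulmx_sumr; apply: eq_bigr => -[[] [p q]] _ /=.
  by rewrite /edge_insert/= path_mx_cons mulmxN !mulmxA.
by rewrite /edge_insert/= !path_mx_cons !mulmxA.
Qed.

Lemma edge_insert_linear Q c X Y o :
  edge_insert Q (c *: X + Y) o = c *: edge_insert Q X o + edge_insert Q Y o.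
Proof.
rewrite /edge_insert; case: o.1.
  by rewrite mulmxDr mulmxDl -scalemxAr -scalemxAl opprD scalerN.
by rewrite mulmxDr mulmxDl -scalemxAr -scalemxAl.
Qed.

Lemma dpath_linear Q c X Y w :
  dpath Q (c *: X + Y) w = c *: dpath Q X w + dpath Q Y w.
Proof.
rewrite /dpath scaler_sumr -big_split/=.
by apply: eq_bigr => o _; rewrite edge_insert_linear.
Qed.

End holonomy.

(** * Variation of holonomies under the motion of one edge *)

Section config_measurability.
Context (R : realType) (N d : nat) (L : {fset vertex d}).
Local Notation adj X := (map_mx Num.conj X^T).
Local Notation cfg := (config R N L).
Local Notation bm := (@bounded_measurable _ cfg R).

Lemma bm_mx_mul (F G : cfg -> 'M[R[i]]_N) :
  (forall i j, bm (fun Q => F Q i j)) -> (forall i j, bm (fun Q => G Q i j)) ->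
  forall i j, bm (fun Q => (F Q *m G Q) i j).
Proof.
move=> bF bG i j.
rewrite (_ : (fun _ => _) = (fun Q => \sum_l F Q i l * G Q l j)).
  by apply: bm_sum => l _; exact: bmM.
by apply/funext => Q; rewrite mxE.
Qed.

Lemma bm_pos_edge (f : edge d) i j : f \in pos_edges L ->
  bm (fun Q : cfg => suval (nth (SU1 R N) Q (index f (pos_edges L))) i j).
Proof.
move=> fp; have fi : (index f (pos_edges L) < #|` pos_edges L|)%N by rewrite index_mem.
pose k := Ordinal fi.
have e (Q : cfg) : nth (SU1 R N) Q (index f (pos_edges L)) = tnth (Q : cfg) k.
  by rewrite (tnth_nth (SU1 R N)).
split; last first.
- exists 1 => Q; apply: unitary_entry_le1.
  by case/andP: (suvalP (nth (SU1 R N) Q (index f (pos_edges L)))).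
- rewrite (_ : _ \o _ = (fun g => complex.Im (suval g i j)) \o (fun Q : cfg => tnth Q k)).
    by apply: measurableT_comp (measurable_Im_suval i j) (measurable_tnth k).
  by apply/funext => Q /=; rewrite e.
- rewrite (_ : _ \o _ = (fun g => complex.Re (suval g i j)) \o (fun Q : cfg => tnth Q k)).
    by apply: measurableT_comp (measurable_Re_suval i j) (measurable_tnth k).
  by apply/funext => Q /=; rewrite e.
Qed.

Lemma bm_edge (f : edge d) i j : bm (fun Q => edge_mx Q f i j).
Proof.
have [fp|fn] := boolP (f \in pos_edges L).
  rewrite (_ : (fun _ => _) = (fun Q : cfg => suval (nth (SU1 R N) Q (index f (pos_edges L))) i j)).
    exact: bm_pos_edge.
  by apply/funext => Q; rewrite /edge_mx fp.
have [fp'|fn'] := boolP (einv f \in pos_edges L); last first.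
  rewrite (_ : (fun _ => _) = (fun=> (1%:M : 'M[R[i]]_N) i j)); first exact: bm_cst.
  by apply/funext => Q; rewrite /edge_mx (negPf fn) (negPf fn').
rewrite (_ : (fun _ => _) =
  (fun Q : cfg => Num.conj (suval (nth (SU1 R N) Q (index (einv f) (pos_edges L))) j i))).
  by apply: bm_conj; exact: bm_pos_edge.
by apply/funext => Q; rewrite /edge_mx (negPf fn) fp' !mxE.
Qed.

Lemma bm_path w i j : bm (fun Q => path_mx Q w i j).
Proof.
elim: w i j => [|f w ih] i j.
  under eq_fun do rewrite path_mx_nil; exact: bm_cst.
by under eq_fun do rewrite path_mx_cons; apply: bm_mx_mul => //; exact: bm_edge.
Qed.

Lemma bm_htrace w : bm (fun Q => htrace Q w).
Proof. by apply: bm_sum => i _; exact: bm_path. Qed.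

Lemma bm_htraces t : bm (fun Q => htraces Q t).
Proof. by apply: bm_prod => w; exact: bm_htrace. Qed.

Variable a : edge d.

Lemma bm_edge_insert X o i j : bm (fun Q => edge_insert a Q X o i j).
Proof.
case: o => -[] [p q]; rewrite /edge_insert /=.
  under eq_fun do rewrite mxE; apply: bmN.
  apply: bm_mx_mul; last exact: bm_path.
  by apply: bm_mx_mul; [exact: bm_path|move=> k l; exact: bm_cst].
apply: bm_mx_mul; last exact: bm_path.
by apply: bm_mx_mul; [exact: bm_path|move=> k l; exact: bm_cst].
Qed.

Lemma bm_dpath X w i j : bm (fun Q => dpath a Q X w i j).
Proof.
under eq_fun do rewrite /dpath summxE.
by apply: bm_sum => o _; exact: bm_edge_insert.
Qed.

Lemma bm_dtrace X w : bm (fun Q => \tr (dpath a Q X w)).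
Proof. by apply: bm_sum => i _; exact: bm_dpath. Qed.

Fixpoint dhtraces (Q : cfg) X t : R[i] :=
  if t is w :: t' then
    \tr (dpath a Q X w) * htraces Q t' + htrace Q w * dhtraces Q X t'
  else 0.

Lemma bm_dhtraces X t : bm (fun Q => dhtraces Q X t).
Proof.
elim: t => [|w t ih] /=; first exact: bm_cst.
apply: bmD; apply: bmM => //; [exact: bm_dtrace|exact: bm_htraces|exact: bm_htrace].
Qed.

End config_measurability.

Section config_flow.
Context (R : realType) (N d : nat) (L : {fset vertex d}).
Local Notation adj X := (map_mx Num.conj X^T).
Local Notation cfg := (config R N L).
Variables (a : edge d) (ap : a \in pos_edges L).
Variables (X : 'M[R[i]]_N) (aX : adj X = - X) (h : R -> SU R N) (C : R).
Hypothesis hC : forall t i j, 0 < t -> t <= 1 ->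
  modc ((suval (h t) - 1%:M - t%:C%C *: X) i j) <= C * t ^+ 2.

Definition edge_flow (t : R) (Q : cfg) : cfg := translate (index a (pos_edges L)) (h t) Q.

Local Notation FD := (@flow_derivative _ cfg R edge_flow).

Lemma nth_edge_flow t Q f : f \in pos_edges L ->
  nth (SU1 R N) (edge_flow t Q) (index f (pos_edges L)) =
  if f == a then SU_mul (h t) (nth (SU1 R N) Q (index f (pos_edges L)))
  else nth (SU1 R N) Q (index f (pos_edges L)).
Proof.
move=> fp; have fi : (index f (pos_edges L) < #|` pos_edges L|)%N by rewrite index_mem.
rewrite -[index f _]/(val (Ordinal fi)) -!tnth_nth tnth_mktuple /=.
suff -> : (index f (pos_edges L) == index a (pos_edges L)) = (f == a) by case: ifP.
by apply/eqP/eqP => [e|->//]; rewrite -(nth_index a fp) e nth_index.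
Qed.

Lemma flow_mx_mul (F F' G G' : cfg -> 'M[R[i]]_N) :
  (forall i j, FD (fun Q => F Q i j) (fun Q => F' Q i j)) ->
  (forall i j, FD (fun Q => G Q i j) (fun Q => G' Q i j)) ->
  forall i j, FD (fun Q => (F Q *m G Q) i j)
                 (fun Q => (F' Q *m G Q + F Q *m G' Q) i j).
Proof.
move=> dF dG i j.
have -> : (fun Q => (F Q *m G Q) i j) = (fun Q => \sum_l F Q i l * G Q l j).
  by apply/funext => Q; rewrite mxE.
have -> : (fun Q => (F' Q *m G Q + F Q *m G' Q) i j) =
    (fun Q => \sum_l (F' Q i l * G Q l j + F Q i l * G' Q l j)).
  by apply/funext => Q; rewrite !mxE -big_split.
by apply: flow_derivative_sum => l; exact: flow_derivativeM.
Qed.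

Lemma flow_moving_edge i j :
  FD (fun Q => edge_mx Q a i j) (fun Q => (X *m edge_mx Q a) i j).
Proof.
split; first exact: bm_edge.
  by apply: bm_mx_mul => k l; [exact: bm_cst|exact: bm_edge].
exists (N%:R * C) => t Q t0 t1.
have -> : edge_mx (edge_flow t Q) a = suval (h t) *m edge_mx Q a.
  by rewrite /edge_mx ap nth_edge_flow// eqxx.
rewrite (_ : _ - _ = ((suval (h t) - 1%:M - t%:C%C *: X) *m edge_mx Q a) i j); last first.
  by rewrite !mulmxBl mul1mx -scalemxAl !mxE.
rewrite mxE (le_trans (modc_sum _ _ _))// -mulrA -[N in N%:R * _]card_ord mulr_natl -sumr_const.
apply: ler_sum => l _; rewrite modcM -[leRHS]mulr1 ler_pM ?modc_ge0//.
  exact: hC.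
exact/unitary_entry_le1/edge_mx_unitary.
Qed.

(** The derivative of the inverse of Q_a is obtained by conjugation, which is
    where the skew-Hermitianness of X is used. *)
Lemma flow_edge f i j :
  FD (fun Q => edge_mx Q f i j) (fun Q => (dedge a Q X f) i j).
Proof.
have [->|fa] := eqVneq f a.
  by rewrite /dedge eqxx; exact: flow_moving_edge.
have [fa'|fa'] := eqVneq f (einv a).
  rewrite /dedge (negPf fa) fa' eqxx.
  have := flow_derivative_conj (flow_moving_edge j i).
  congr (flow_derivative _ _ _); apply/funext => Q.
    by rewrite edge_mx_einv !mxE.
  rewrite edge_mx_einv -mulmxN -aX -adjM.
  by rewrite !mxE.
rewrite /dedge (negPf fa) (negPf fa').
under [X in flow_derivative _ _ X]eq_fun do rewrite mxE.
apply: flow_derivative_cst; first exact: bm_edge.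
move=> t Q; rewrite /edge_mx; case: ifPn => [fp|fn].
  by rewrite nth_edge_flow// (negPf fa).
case: ifPn => // fp; rewrite nth_edge_flow//.
by rewrite (can2_eq (@einvK d) (@einvK d)) (negPf fa').
Qed.

Lemma flow_path w i j :
  FD (fun Q => path_mx Q w i j) (fun Q => dpath a Q X w i j).
Proof.
elim: w i j => [|f w ih] i j.
  under [X in flow_derivative _ _ X]eq_fun do rewrite dpath_nil mxE.
  by apply: flow_derivative_cst; [exact: bm_path|move=> t Q; rewrite !path_mx_nil].
under eq_fun do rewrite path_mx_cons.
under [X in flow_derivative _ _ X]eq_fun do rewrite dpath_cons.
by apply: flow_mx_mul => // k l; exact: flow_edge.
Qed.

Lemma flow_htrace w : FD (fun Q => htrace Q w) (fun Q => \tr (dpath a Q X w)).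
Proof. by apply: flow_derivative_sum => i; exact: flow_path. Qed.

Lemma flow_htraces t : FD (fun Q => htraces Q t) (fun Q => dhtraces a Q X t).
Proof.
elim: t => [|w t ih] /=.
  by apply: flow_derivative_cst; [exact: bm_htraces|move=> t Q; rewrite /htraces !big_nil].
under eq_fun do rewrite htraces_cons.
exact: flow_derivativeM (flow_htrace w) ih.
Qed.

End config_flow.

(** * Integration by parts against the Gibbs weight *)

Section action.
Context (R : realType) (N d : nat) (L : {fset vertex d}) (beta : R).
Local Notation cfg := (config R N L).
Implicit Types (Q : cfg).

Definition plaquettes : seq (seq (edge d)) :=
  [seq map val (tval p) |
    p <- [seq p <- index_enum {: 4.-tuple (edges L)} | pos_plaquette (map val (tval p))]].

(** 2 Re Tr Q_p is the sum of the traces of p and of its inverse; listing both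
    makes the action a linear combination of holonomy traces. *)
Definition both_orientations (P : seq (seq (edge d))) :=
  flatten [seq [:: p; word_inv p] | p <- P].

Lemma big_both_orientations (V : nmodType) (P : seq (seq (edge d))) (F : seq (edge d) -> V) :
  \sum_(p <- both_orientations P) F p = \sum_(p <- P) (F p + F (word_inv p)).
Proof.
rewrite /both_orientations big_flatten big_map; apply: eq_bigr => p _.
by rewrite big_cons big_seq1.
Qed.

Definition action Q : R :=
  N%:R * beta * \sum_(p <- plaquettes) complex.Re (htrace Q p).

Lemma boltzmannE Q : boltzmann beta Q = expR (action Q).
Proof.
rewrite /boltzmann /action /plaquettes big_map big_filter.
by congr (expR (_ * _)).
Qed.

Lemma actionE Q : (action Q)%:C%C =
  \sum_(p <- both_orientations plaquettes) (N%:R * beta / 2)%:C%C * htrace Q p.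
Proof.
rewrite /action big_both_orientations rmorphM rmorph_sum mulr_sumr.
apply: eq_bigr => p _; rewrite -mulrDr htrace_inv -rmorphM.
case: (htrace Q p) => x y.
by apply/eqP; rewrite eq_complex /=; apply/andP; split; apply/eqP; field.
Qed.

Definition daction a Q X : R[i] :=
  \sum_(p <- both_orientations plaquettes) (N%:R * beta / 2)%:C%C * \tr (dpath a Q X p).

Lemma bm_daction a X : @bounded_measurable _ cfg R (fun Q => daction a Q X).
Proof. by apply: bm_sum => p _; apply: bmZ; exact: bm_dtrace. Qed.

Lemma bm_action : @bounded_measurable _ cfg R (fun Q => (action Q)%:C%C).
Proof.
under eq_fun do rewrite actionE.
by apply: bm_sum => p _; apply: bmZ; exact: bm_htrace.
Qed.

Lemma bm_boltzmann : @bounded_measurable _ cfg R (fun Q => (boltzmann beta Q)%:C%C).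
Proof.
have [mS _ [A hA]] := bm_action.
under eq_fun do rewrite boltzmannE.
apply: (bm_real (C := expR A)); first exact: measurableT_comp mS.
move=> Q; rewrite ger0_norm ?expR_ge0// ler_expR (le_trans (ler_norm _))//.
by rewrite -modc_real.
Qed.

(** The variation in direction X of the (j, k) entry of Q_w times the traces of
    t times the Gibbs weight, divided by the Gibbs weight. *)
Definition variation a Q X w t j k : R[i] :=
  dpath a Q X w j k * htraces Q t + path_mx Q w j k * dhtraces a Q X t +
  path_mx Q w j k * htraces Q t * daction a Q X.

Lemma bm_variation a X w t j k :
  @bounded_measurable _ cfg R (fun Q => variation a Q X w t j k).
Proof.
apply: bmD; last first.
  by apply: bmM; [apply: bmM; [exact: bm_path|exact: bm_htraces]|exact: bm_daction].
by apply: bmD; apply: bmM; [exact: bm_dpath|exact: bm_htraces|exact: bm_path|exact: bm_dhtraces].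
Qed.

Lemma dhtraces_linear a Q c X Y t :
  dhtraces a Q (c *: X + Y) t = c * dhtraces a Q X t + dhtraces a Q Y t.
Proof.
elim: t => [|w t ih] /=; first by rewrite mulr0 addr0.
by rewrite dpath_linear linearD linearZ/= ih; ring.
Qed.

Lemma daction_linear a Q c X Y :
  daction a Q (c *: X + Y) = c * daction a Q X + daction a Q Y.
Proof.
rewrite /daction mulr_sumr -big_split/=; apply: eq_bigr => p _.
by rewrite dpath_linear linearD linearZ/=; ring.
Qed.

Lemma variation_linear a Q c X Y w t j k :
  variation a Q (c *: X + Y) w t j k =
  c * variation a Q X w t j k + variation a Q Y w t j k.
Proof.
by rewrite /variation dhtraces_linear daction_linear dpath_linear !mxE; ring.
Qed.

End action.

Section integration_by_parts.
Context (R : realType) (N d : nat) (L : {fset vertex d}) (beta : R).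
Variable sigma : probability (SU R N) R.
Hypothesis haar : is_haar sigma.
Local Notation cfg := (config R N L).
Variables (a : edge d) (ap : a \in pos_edges L).
Variables (w : seq (edge d)) (t : seq (seq (edge d))).
Let mu := power_measure sigma #|` pos_edges L|.

(** This vanishes for the velocities X of SU(N) and is complex linear in X, so
    it vanishes on their complex span, the traceless matrices. *)
Definition ibp X j k : R[i] :=
  cintegral mu (fun Q : cfg => (boltzmann beta Q)%:C%C * variation beta a Q X w t j k).

Lemma ibp_linear c X Y j k : ibp (c *: X + Y) j k = c * ibp X j k + ibp Y j k.
Proof.
have bX Z : @bounded_measurable _ cfg R
    (fun Q => (boltzmann beta Q)%:C%C * variation beta a Q Z w t j k).
  by apply: bmM; [exact: bm_boltzmann|exact: bm_variation].
rewrite /ibp.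
rewrite -cintegralZ// -cintegralD//; last exact: bmZ.
congr cintegral; apply/funext => Q; rewrite variation_linear.
by rewrite mulrDr; congr (_ + _); exact: mulrCA.
Qed.

Lemma ibpD X Y j k : ibp (X + Y) j k = ibp X j k + ibp Y j k.
Proof. by have := ibp_linear 1 X Y j k; rewrite scale1r mul1r. Qed.

Lemma ibp0 j k : ibp 0 j k = 0.
Proof. by have := ibpD 0 0 j k; rewrite addr0 => /eqP; rewrite -subr_eq0 opprD addNKr oppr_eq0 => /eqP. Qed.

Lemma ibpZ c X j k : ibp (c *: X) j k = c * ibp X j k.
Proof. by have := ibp_linear c X 0 j k; rewrite addr0 ibp0 addr0. Qed.

Lemma ibp_sum (I : Type) (r : seq I) (X : I -> 'M[R[i]]_N) j k :
  ibp (\sum_(i <- r) X i) j k = \sum_(i <- r) ibp (X i) j k.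
Proof. by elim: r => [|i r ih]; rewrite ?big_nil ?ibp0// !big_cons ibpD ih. Qed.

Lemma ibp_velocity X j k : SU_velocity X -> ibp X j k = 0.
Proof.
move=> [aX [h [C hC]]]; rewrite /ibp.
have mf u : measurable_fun setT (@edge_flow R N d L a h u) by exact: measurable_translate.
have pf u A : measurable A -> mu (edge_flow a h u @^-1` A) = mu A.
  by move=> mA; exact: power_measure_translate.
pose F := (fun Q : cfg => (boltzmann beta Q)%:C%C * (path_mx Q w j k * htraces Q t)).
apply: (integral_flow_derivative mf pf (f := F)).
have fa : flow_derivative (edge_flow a h) (fun Q : cfg => (action beta Q)%:C%C)
    (fun Q => daction beta a Q X).
  under eq_fun do rewrite actionE.
  apply: flow_derivative_sum => p; apply: flow_derivativeZ.
  exact: (flow_htrace ap aX hC).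
have fe := flow_derivative_exp fa.
have fp := flow_derivativeM (flow_path ap aX hC w j k) (flow_htraces ap aX hC t).
have := flow_derivativeM fe fp.
congr (flow_derivative _ _ _); apply/funext => Q; first by rewrite /F boltzmannE.
rewrite boltzmannE /variation; move: (expR _)%:C%C (daction _ _ _ _) => r D.
move: (path_mx Q w j k) (htraces Q t) (dpath _ _ _ _ _ _) (dhtraces _ _ _ _) => *.
ring.
Qed.

(** E_lm is half of X_1 - i X_2, where X_1 = E_lm - E_ml and
    X_2 = i E_lm + i E_ml are velocities up to the factor 4. *)
Lemma ibp_offdiag j k l m : l != m -> ibp (delta_mx l m) j k = 0.
Proof.
move=> lm.
pose J : R[i] := 'i.
have JJ : J * J = -1 by rewrite -expr2 /J sqrCi.
have cJ : Num.conj J = - J by rewrite /J conjCi.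
have e1 : (1 : R[i]) * Num.conj 1 = 1 by rewrite rmorph1 mulr1.
have eJ : J * Num.conj J = 1 by rewrite cJ mulrN JJ opprK.
have v1 := velocity_offdiag lm e1; have vJ := velocity_offdiag lm eJ.
have {v1} := ibp_velocity j k v1; have {vJ} := ibp_velocity j k vJ.
rewrite rmorph1 cJ; clear cJ e1 eJ.
move: (delta_mx m l) (delta_mx l m) => A B.
clearbody J; rewrite !ibpZ => /eqP; rewrite mulf_eq0 pnatr_eq0 => /eqP h2.
move=> /eqP; rewrite mulf_eq0 pnatr_eq0 => /eqP h1.
have e : 2 *: B = (1 *: B - 1 *: A) + (- J) *: (J *: B - - J *: A).
  rewrite !scaleNr opprK scalerDr !scalerA JJ !scaleN1r opprD !opprK !scale1r.
  by rewrite scaler_nat mulr2n addrACA addNr addr0.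
have : ibp (2 *: B) j k = 0 by rewrite e ibpD h1 ibpZ h2 mulr0 addr0.
by rewrite ibpZ => /eqP; rewrite mulf_eq0 pnatr_eq0 => /eqP.
Qed.

Lemma ibp_diag j k l m : ibp (delta_mx l l - delta_mx m m) j k = 0.
Proof.
have [->|lm] := eqVneq l m; first by rewrite subrr ibp0.
have := ibp_velocity j k (velocity_diag R lm); rewrite !ibpZ => /eqP.
rewrite !mulf_eq0 pnatr_eq0/= (negPf (neq0Ci _))/=.
by move/eqP.
Qed.

(** The sum of the integrals over the traceless parts of all E_jk, with the
    matching entry (j, k) of Q_w. The trace part of E_jj is removed by writing
    N E_jj - 1 as the sum over k of E_jj - E_kk. *)
Lemma ibp_traceless (N0 : (0 < N)%N) :
  \sum_j \sum_k ibp (delta_mx j k) j k - N%:R^-1 * \sum_j ibp 1%:M j j = 0.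
Proof.
have N0' : (N%:R : R[i]) != 0 by rewrite pnatr_eq0 -lt0n.
have h j : \sum_k ibp (delta_mx j k) j k = ibp (delta_mx j j) j j.
  by rewrite (bigD1 j)//= big1 ?addr0// => k kj; rewrite ibp_offdiag// eq_sym.
rewrite mulr_sumr (eq_bigr _ (fun j _ => h j)) -sumrB big1// => j _.
have e : \sum_k (delta_mx j j - delta_mx k k) = N%:R *: delta_mx j j - 1%:M :> 'M[R[i]]_N.
  rewrite sumrB sumr_const card_ord scaler_nat; congr (_ - _).
  exact/esym/mx1_sum_delta.
have : ibp (N%:R *: delta_mx j j - 1%:M) j j = 0.
  by rewrite -e ibp_sum big1// => k _; exact: ibp_diag.
rewrite -scaleN1r ibpD !ibpZ mulN1r => /eqP; rewrite subr_eq0 => /eqP <-.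
by rewrite mulKf// subrr.
Qed.

End integration_by_parts.

(** * The Schwinger-Dyson identity in terms of traces *)

Section insertions.
Context (R : realType) (N d : nat) (L : {fset vertex d}).
Local Notation cfg := (config R N L).
Implicit Types (Q : cfg) (e f : edge d) (b w p : seq (edge d)).
Implicit Types (t : seq (seq (edge d))) (o : bool * (seq (edge d) * seq (edge d))).

Definition occ_sign o : R := (-1) ^+ o.1.

Lemma normr_occ_sign o : `|occ_sign o| = 1.
Proof. by rewrite /occ_sign normrX normrN1 expr1n. Qed.

Lemma occ_split e w o : o \in occ e w ->
  w = o.2.1 ++ (if o.1 then einv e else e) :: o.2.2.
Proof.
elim: w o => [//|f w ih] o; rewrite occ_cons mem_cat => /orP[|].
  have [->|_] := eqVneq f e; first by rewrite inE => /eqP ->.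
  by have [->|_] := eqVneq f (einv e); rewrite ?inE// => /eqP ->.
by move=> /mapP[x xo ->] /=; rewrite {1}(ih _ xo).
Qed.

Variable a : edge d.

(** The two parts of the word on either side of the inserted matrix: the
    insertion is before a letter a and after a letter a^-1. *)
Definition cut_before o := if o.1 then rcons o.2.1 (einv a) else o.2.1.
Definition cut_after o := if o.1 then o.2.2 else a :: o.2.2.

Lemma cut_cat w o : o \in occ a w -> cut_before o ++ cut_after o = w.
Proof.
move=> /occ_split ->; rewrite /cut_before /cut_after; case: o.1 => //.
by rewrite cat_rcons.
Qed.

Lemma edge_insertE Q X o :
  edge_insert a Q X o = (occ_sign o)%:C%C *: (path_mx Q (cut_before o) *m X *m path_mx Q (cut_after o)).
Proof.
case: o => -[] [p q]; rewrite /edge_insert /occ_sign /cut_before /cut_after/=.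
  by rewrite expr1 rmorphN1 scaleN1r.
by rewrite expr0 scale1r.
Qed.

Lemma sum_dpath_delta Q w :
  \sum_j \sum_k dpath a Q (delta_mx j k) w j k =
  \sum_(o <- occ a w) (occ_sign o)%:C%C * (htrace Q (cut_before o) * htrace Q (cut_after o)).
Proof.
under eq_bigr => j _ do under eq_bigr => k _ do rewrite /dpath summxE.
under eq_bigr => j _ do rewrite exchange_big.
rewrite exchange_big; apply: eq_bigr => o _.
rewrite /htrace -sum_trace_delta mulr_sumr; apply: eq_bigr => j _.
by rewrite mulr_sumr; apply: eq_bigr => k _; rewrite edge_insertE mxE.
Qed.

Lemma sum_dtrace_delta Q w l :
  \sum_j \sum_k path_mx Q w j k * \tr (dpath a Q (delta_mx j k) l) =
  \sum_(o <- occ a l) (occ_sign o)%:C%C * htrace Q (w ++ cut_after o ++ cut_before o).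
Proof.
transitivity (\sum_j \sum_k \sum_(o <- occ a l)
    path_mx Q w j k * \tr (edge_insert a Q (delta_mx j k) o)).
  by apply: eq_bigr => j _; apply: eq_bigr => k _; rewrite /dpath linear_sum/= mulr_sumr.
under eq_bigr => j _ do rewrite exchange_big.
rewrite exchange_big; apply: eq_bigr => o _.
rewrite /htrace !path_mx_cat mulmxA -sum_entry_trace_delta mulr_sumr; apply: eq_bigr => j _.
by rewrite mulr_sumr; apply: eq_bigr => k _; rewrite edge_insertE linearZ/= mulrCA.
Qed.

Definition occ_count w : R := \sum_(o <- occ a w) occ_sign o.

Lemma normr_occ_count w : `|occ_count w| <= (size w)%:R.
Proof.
rewrite (le_trans (ler_norm_sum _ _ _))//.
rewrite (eq_bigr (fun=> 1)) => [|o _]; last exact: normr_occ_sign.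
by rewrite big_const_seq count_predT iter_addr_0 ler_nat size_occ.
Qed.

(** The identity matrix can be inserted without effect, so its variation only
    counts the occurrences with their signs. *)
Lemma dpath1 Q w : dpath a Q 1%:M w = (occ_count w)%:C%C *: path_mx Q w.
Proof.
rewrite /dpath /occ_count rmorph_sum scaler_suml big_seq [RHS]big_seq.
apply: eq_bigr => o oo; by rewrite edge_insertE mulmx1 -path_mx_cat (cut_cat oo).
Qed.

Definition totsize t : nat := \sum_(w <- t) size w.

Lemma modc_dhtraces1 Q t : modc (dhtraces a Q 1%:M t) <= (totsize t)%:R * N%:R ^+ size t.
Proof.
elim: t => [|w t ih] /=; first by rewrite modc0 /totsize big_nil mul0r.
rewrite /totsize big_cons natrD mulrDl (le_trans (modcD _ _))// lerD//.
  rewrite dpath1 linearZ/= -/(htrace Q w) !modcM modc_real exprS -mulrA.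
  rewrite ler_pM ?mulr_ge0 ?modc_ge0 ?normr_occ_count//.
  by rewrite ler_pM ?modc_ge0 ?modc_htrace ?modc_htraces.
by rewrite modcM exprS mulrCA ler_pM ?modc_ge0 ?modc_htrace.
Qed.

(** The terms that join w to one of the words of t. They lose two traces and
    are therefore of relative order N^-2. *)
Definition merge Q w t : R[i] :=
  \sum_j \sum_k path_mx Q w j k * dhtraces a Q (delta_mx j k) t.

Lemma modc_merge Q w t : modc (merge Q w t) <= (totsize t)%:R * N%:R ^+ size t.
Proof.
elim: t => [|l t ih].
  rewrite /merge big1 ?modc0 ?/totsize ?big_nil ?mul0r// => j _.
  by rewrite big1// => k _; rewrite mulr0.
have -> : merge Q w (l :: t) =
    (\sum_(o <- occ a l) (occ_sign o)%:C%C * htrace Q (w ++ cut_after o ++ cut_before o)) * htraces Q t +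
    htrace Q l * merge Q w t.
  rewrite /merge -sum_dtrace_delta mulr_suml mulr_sumr -big_split/=.
  apply: eq_bigr => j _; rewrite mulr_suml mulr_sumr -big_split/=.
  by apply: eq_bigr => k _; ring.
rewrite /totsize big_cons natrD mulrDl (le_trans (modcD _ _))// lerD//.
  rewrite modcM /= exprS mulrA ler_pM ?modc_ge0 ?modc_htraces//.
  rewrite (le_trans (modc_sum _ _ _))//.
  apply: (@le_trans _ _ (\sum_(o <- occ a l) N%:R)).
    by apply: ler_sum => o _; rewrite modcM modc_real normr_occ_sign mul1r modc_htrace.
  rewrite big_const_seq count_predT iter_addr_0 -[leLHS]mulr_natl.
  by rewrite ler_wpM2r ?ler0n// ler_nat size_occ.
by rewrite modcM /= exprS mulrCA ler_pM ?modc_ge0 ?modc_htrace.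
Qed.

Variable beta : R.
Local Notation PP := (both_orientations (plaquettes L)).
Local Notation kappa := (N%:R * beta / 2)%:C%C.

(** The terms of leading order: w is cut at its occurrences of a, or joined to a
    plaquette. In the second sum the term with N^-1 is the part of the trace
    correction that varies the action; it gains one trace, hence a factor N,
    and so it has the same order as the other terms. *)
Definition sd_main Q w t : R[i] :=
  \sum_(o <- occ a w) (occ_sign o)%:C%C * htraces Q [:: cut_before o, cut_after o & t] +
  \sum_(p <- PP) \sum_(o <- occ a p) kappa * (occ_sign o)%:C%C *
    (htraces Q ((w ++ cut_after o ++ cut_before o) :: t) - N%:R^-1 * htraces Q [:: w, p & t]).

Definition sd_error Q w t : R[i] :=
  merge Q w t - N%:R^-1 * ((occ_count w)%:C%C * htraces Q (w :: t) +
                           htrace Q w * dhtraces a Q 1%:M t).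

(** The integrand of [ibp_traceless], evaluated with [sum_trace_delta] and
    [sum_entry_trace_delta]. *)
Lemma variation_trace Q w t :
  \sum_j \sum_k variation beta a Q (delta_mx j k) w t j k -
  N%:R^-1 * \sum_j variation beta a Q 1%:M w t j j =
  sd_main Q w t + sd_error Q w t.
Proof.
have e1 : \sum_j \sum_k variation beta a Q (delta_mx j k) w t j k =
    (\sum_(o <- occ a w) (occ_sign o)%:C%C * (htrace Q (cut_before o) * htrace Q (cut_after o))) * htraces Q t +
    merge Q w t + htraces Q t * \sum_(p <- PP) kappa *
      \sum_(o <- occ a p) (occ_sign o)%:C%C * htrace Q (w ++ cut_after o ++ cut_before o).
  rewrite -sum_dpath_delta /merge mulr_suml -big_split mulr_sumr /=.
  under [X in _ + X]eq_bigr => p _ do rewrite -sum_dtrace_delta.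
  transitivity (\sum_j \sum_k (dpath a Q (delta_mx j k) w j k * htraces Q t +
     path_mx Q w j k * dhtraces a Q (delta_mx j k) t) +
     \sum_j \sum_k \sum_(p <- PP) htraces Q t * (kappa * (path_mx Q w j k * \tr (dpath a Q (delta_mx j k) p)))).
    rewrite -big_split; apply: eq_bigr => j _; rewrite -big_split; apply: eq_bigr => k _.
    rewrite /variation /daction; congr (_ + _); rewrite mulr_sumr.
    by apply: eq_bigr => p _; ring.
  congr (_ + _).
    by apply: eq_bigr => j _; rewrite mulr_suml -big_split.
  transitivity (\sum_j \sum_(p <- PP) \sum_k
    htraces Q t * (kappa * (path_mx Q w j k * \tr (dpath a Q (delta_mx j k) p)))).
    by apply: eq_bigr => j _; exact: exchange_big.
  rewrite exchange_big; apply: eq_bigr => p _.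
  rewrite !mulr_sumr; apply: eq_bigr => j _; rewrite !mulr_sumr.
  by apply: eq_bigr => k _.
have e2 : \sum_j variation beta a Q 1%:M w t j j =
    (occ_count w)%:C%C * htraces Q (w :: t) + htrace Q w * dhtraces a Q 1%:M t +
    htraces Q (w :: t) * \sum_(p <- PP) kappa * ((occ_count p)%:C%C * htrace Q p).
  rewrite /variation !big_split/= -!mulr_suml; congr (_ + _ + _).
    rewrite htraces_cons mulrA; congr (_ * _).
    by rewrite dpath1 /htrace /mxtrace mulr_sumr; apply: eq_bigr => j _; rewrite mxE.
  rewrite htraces_cons; congr (_ * _); rewrite /daction.
  by apply: eq_bigr => p _; rewrite dpath1 linearZ.
rewrite e1 e2 /sd_main /sd_error.
have e3 : \sum_(p <- PP) \sum_(o <- occ a p) kappa * (occ_sign o)%:C%C *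
    (htraces Q ((w ++ cut_after o ++ cut_before o) :: t) - N%:R^-1 * htraces Q [:: w, p & t]) =
  htraces Q t * \sum_(p <- PP) kappa *
      \sum_(o <- occ a p) (occ_sign o)%:C%C * htrace Q (w ++ cut_after o ++ cut_before o)
  - N%:R^-1 * (htraces Q (w :: t) * \sum_(p <- PP) kappa * ((occ_count p)%:C%C * htrace Q p)).
  rewrite !mulr_sumr -sumrB; apply: eq_bigr => p _.
  rewrite /occ_count rmorph_sum mulr_suml !mulr_sumr -sumrB; apply: eq_bigr => o _.
  by rewrite !htraces_cons; ring.
rewrite e3.
have -> : \sum_(o <- occ a w) (occ_sign o)%:C%C * htraces Q [:: cut_before o, cut_after o & t] =
  (\sum_(o <- occ a w) (occ_sign o)%:C%C * (htrace Q (cut_before o) * htrace Q (cut_after o))) * htraces Q t.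
  by rewrite mulr_suml; apply: eq_bigr => o _; rewrite !htraces_cons; ring.
by ring.
Qed.

Lemma modc_sd_error Q w t : (0 < N)%N ->
  modc (sd_error Q w t) <= (2 * totsize t + size w)%:R * N%:R ^+ size t.
Proof.
move=> N0; have N0' : (N%:R : R) != 0 by rewrite pnatr_eq0 -lt0n.
rewrite /sd_error (le_trans (modcB _ _))// mulSn mul1n -addnA natrD mulrDl.
rewrite lerD ?modc_merge// modcM modcV modc_nat ler_pdivrMl ?ltr0n//.
rewrite (le_trans (modcD _ _))// addnC natrD mulrDl mulrDr lerD//.
  rewrite modcM modc_real mulrCA ler_pM ?modc_ge0 ?normr_occ_count//.
  by rewrite -exprS modc_htraces.
by rewrite modcM ler_pM ?modc_ge0 ?modc_htrace ?modc_dhtraces1.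
Qed.

End insertions.

Section loop_equation.
Context (R : realType) (N d : nat) (L : {fset vertex d}) (beta : R).
Local Notation cfg := (config R N L).
Implicit Types (Q : cfg) (e f : edge d) (b w p : seq (edge d)).
Implicit Types (t : seq (seq (edge d))) (o : bool * (seq (edge d) * seq (edge d))).
Local Notation PP := (both_orientations (plaquettes L)).
Local Notation kappa := (N%:R * beta / 2)%:C%C.

Definition split_words e o : seq (seq (edge d)) :=
  if o.1 then [:: o.2.1; o.2.2] else [:: e :: o.2.1; e :: o.2.2].

Definition deform e b o : seq (edge d) :=
  if o.1 then b ++ o.2.2 ++ o.2.1 else (e :: b) ++ (e :: o.2.2) ++ o.2.1.

(** The leading terms for the word e b, with the term N Tr Q_{e b} that the
    first letter contributes itself set apart. In this form the equation does
    not depend on whether e or its inverse is the positively oriented edge. *)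
Definition loop_terms Q e b t : R[i] :=
  N%:R * htraces Q ((e :: b) :: t) +
  \sum_(o <- occ e b) (occ_sign R o)%:C%C * htraces Q (split_words e o ++ t) +
  \sum_(p <- PP) \sum_(o <- occ e p) kappa * (occ_sign R o)%:C%C *
    (htraces Q (deform e b o :: t) - N%:R^-1 * htraces Q [:: e :: b, p & t]).

Lemma htrace_rcons Q w f : htrace Q (rcons w f) = htrace Q (f :: w).
Proof. by rewrite -cats1 htrace_cat. Qed.

Lemma sd_main_pos Q a b t : sd_main a beta Q (a :: b) t = loop_terms Q a b t.
Proof.
rewrite /sd_main /loop_terms; congr (_ + _); last first.
  apply: eq_bigr => p _; apply: eq_bigr => -[[] [u v]] _ //.
  congr (_ * (_ - _)); rewrite /deform /cut_before /cut_after/= !htraces_cons; congr (_ * _).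
  by rewrite /= -!rcons_cat htrace_conjugate.
rewrite occ_cons eqxx big_cons big_map; congr (_ + _).
  by rewrite /occ_sign expr0 rmorph1 mul1r htraces_cons /cut_before htrace_nil.
apply: eq_bigr => -[[] [u v]] _ //; congr (_ * _).
by rewrite /cut_before /cut_after /split_words/= !htraces_cons -(htrace_conjugate Q a u).
Qed.

(** If the first letter is the inverse of the positive edge a, it is moved to
    the end of the word; the insertion then takes place after it and all signs
    are reversed. *)
Lemma sd_main_neg Q a b t : a != einv a ->
  sd_main a beta Q (rcons b (einv a)) t = - loop_terms Q (einv a) b t.
Proof.
move=> aa; have ea : (einv a == a) = false by rewrite eq_sym (negPf aa).
(* The last letter of the word cancels against the letter a it meets. *)
have path_cancel (x : seq (edge d)) u :
    htrace Q (rcons x (einv a) ++ a :: u) = htrace Q (x ++ u).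
  rewrite cat_rcons /htrace !path_mx_cat !path_mx_cons mulmxA.
  by rewrite -[path_mx Q x *m edge_mx Q (einv a) *m _]mulmxA [_ *m (_ *m path_mx Q u)]mulmxA edge_mxVl mul1mx.
have flip o : occ_sign R (~~ o.1, o.2) = - occ_sign R o.
  by case: o => -[] o; rewrite /occ_sign /= ?expr0 ?expr1 ?opprK.
have e1 : \sum_(o <- occ a (rcons b (einv a))) (occ_sign R o)%:C%C *
      htraces Q [:: cut_before a o, cut_after a o & t] =
    - (N%:R * htraces Q ((einv a :: b) :: t) + \sum_(o <- occ (einv a) b)
      (occ_sign R o)%:C%C * htraces Q (split_words (einv a) o ++ t)).
  rewrite occ_rcons ea eqxx big_cat big_seq1 big_map (occ_einv _ aa) big_map addrC opprD.
  congr (_ + _); last first.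
    have -> : occ_sign R (true, (b, [::])) = -1 by exact: expr1.
    rewrite rmorphN1 mulN1r /cut_before /cut_after/= !htraces_cons htrace_nil.
    by rewrite htrace_rcons mulrCA mulrA.
  rewrite -sumrN; apply: eq_bigr => -[s [u v]] _.
  rewrite flip rmorphN mulNr opprK; congr (_ * _); case: s; rewrite /cut_before /cut_after /split_words/= !htraces_cons.
    by rewrite !htrace_rcons.
  by rewrite htrace_conjugate.
have e2 p : \sum_(o <- occ a p) kappa * (occ_sign R o)%:C%C *
    (htraces Q ((rcons b (einv a) ++ cut_after a o ++ cut_before a o) :: t) -
     N%:R^-1 * htraces Q [:: rcons b (einv a), p & t]) =
  - \sum_(o <- occ (einv a) p) kappa * (occ_sign R o)%:C%C *
    (htraces Q (deform (einv a) b o :: t) - N%:R^-1 * htraces Q [:: einv a :: b, p & t]).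
  rewrite (occ_einv _ aa) big_map -sumrN; apply: eq_bigr => -[s [u v]] _.
  rewrite flip rmorphN mulrN mulNr opprK; congr (_ * (_ - _)); last first.
    by rewrite !htraces_cons htrace_rcons.
  rewrite !htraces_cons; congr (_ * _).
  case: s; rewrite /cut_before /cut_after /deform/=.
    by rewrite -cat_rcons -!rcons_cat htrace_rcons cat_rcons.
  exact: path_cancel.
rewrite /sd_main /loop_terms e1 (eq_bigr _ (fun p _ => e2 p)) sumrN.
by rewrite -opprD.
Qed.

End loop_equation.

(** * Gibbs expectations *)

Section gibbs.
Context (R : realType) (N d : nat) (L : {fset vertex d}) (beta : R).
Variable sigma : probability (SU R N) R.
Local Notation cfg := (config R N L).
Local Notation bm := (@bounded_measurable _ cfg R).
Let mu := power_measure sigma #|` pos_edges L|.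
Local Notation Z := (@partition_function R N d L sigma beta).
Local Notation gE := (@gibbs_expectation R N d L sigma beta).

(** The action is bounded, so its exponential is bounded below. *)
Lemma partition_function_gt0 : 0 < Z.
Proof.
have [mS _ [A hA]] := bm_action N L beta.
have [i1 _] := bm_integrable mu (bm_boltzmann N L beta).
apply: (@lt_le_trans _ _ (expR (- A))); first exact: expR_gt0.
rewrite -[leLHS](Rintegral_prob_cst mu) /partition_function.
apply: le_Rintegral => //.
  exact: (bm_integrable mu (bm_cst cfg (expR (- A))%:C%C)).1.
move=> Q _; rewrite boltzmannE ler_expR.
have := hA Q; rewrite modc_real ler_norml => /andP[]; by [].
Qed.

Lemma gibbs_expectationE f : bm f ->
  gE f = (Z^-1)%:C%C * cintegral mu (fun Q => (boltzmann beta Q)%:C%C * f Q).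
Proof.
move=> bf; have bb := bm_boltzmann N L beta.
rewrite -cintegralZ; last exact: bmM.
rewrite /gibbs_expectation /gibbs_integral /cintegral; congr Complex.
  apply: eq_Rintegral => Q _.
  by rewrite mulrA -rmorphM complexReM /= mul0r subr0.
apply: eq_Rintegral => Q _.
by rewrite mulrA -rmorphM complexImM /= mul0r addr0.
Qed.

Lemma gibbsD f g : bm f -> bm g -> gE (fun Q => f Q + g Q) = gE f + gE g.
Proof.
move=> bf bg; have bb := bm_boltzmann N L beta.
rewrite !gibbs_expectationE//; last exact: bmD.
rewrite -mulrDr -cintegralD; [|exact: bmM|exact: bmM].
by congr (_ * cintegral _ _); apply/funext => Q; rewrite mulrDr.
Qed.

Lemma gibbsZ c f : bm f -> gE (fun Q => c * f Q) = c * gE f.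
Proof.
move=> bf; have bb := bm_boltzmann N L beta.
rewrite !gibbs_expectationE//; last exact: bmZ.
rewrite [RHS]mulrCA; congr (_ * _); rewrite -cintegralZ; last exact: bmM.
by congr (cintegral _ _); apply/funext => Q; rewrite mulrCA.
Qed.

Lemma gibbs_sum (I : Type) (r : seq I) (f : I -> cfg -> R[i]) :
  (forall i, bm (f i)) -> gE (fun Q => \sum_(i <- r) f i Q) = \sum_(i <- r) gE (f i).
Proof.
move=> bf; elim: r => [|i r ih].
  rewrite big_nil; under eq_fun do rewrite big_nil -(mul0r 1).
  by rewrite (gibbsZ 0 (bm_cst _ 1)) mul0r.
rewrite big_cons -ih; under eq_fun do rewrite big_cons.
by rewrite gibbsD//; exact: bm_sum.
Qed.

Lemma gibbs1 : gE (fun=> 1) = 1.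
Proof.
rewrite gibbs_expectationE; last exact: bm_cst.
under eq_fun do rewrite mulr1.
apply/eqP; rewrite eq_complex; apply/andP; split; apply/eqP; rewrite /cintegral /=.
  by rewrite mul0r subr0 mulVf// gt_eqF// partition_function_gt0.
by rewrite mul0r addr0 (Rintegral_prob_cst mu) mulr0.
Qed.

Lemma modc_gibbs_le f C : bm f -> (forall Q, modc (f Q) <= C) -> modc (gE f) <= 2 * C.
Proof.
move=> bf fC; have bb := bm_boltzmann N L beta.
rewrite gibbs_expectationE// modcM modc_real.
have Z0 := partition_function_gt0.
rewrite ger0_norm ?invr_ge0 ?(ltW Z0)// mulrC ler_pdivrMr//.
apply: modc_cintegral_le => // Q; exact: expR_ge0.
Qed.

Hypothesis haar : is_haar sigma.

(** By [ibp_traceless] the expectation of the leading terms is minus that of the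
    error terms. *)
Lemma gibbs_sd a w t : (0 < N)%N -> a \in pos_edges L ->
  modc (gE (fun Q => sd_main a beta Q w t)) <=
  2 * ((2 * totsize t + size w)%:R * N%:R ^+ size t).
Proof.
move=> N0 ap; have bb := bm_boltzmann N L beta.
have bv X j k : bm (fun Q => variation beta a Q X w t j k) by exact: bm_variation.
have bS : bm (fun Q => \sum_j \sum_k variation beta a Q (delta_mx j k) w t j k -
  N%:R^-1 * \sum_j variation beta a Q 1%:M w t j j).
  apply: bmB; first by apply: bm_sum => j _; apply: bm_sum => k _; exact: bv.
  by apply: bmZ; apply: bm_sum => j _; exact: bv.
have bM : bm (fun Q => sd_main a beta Q w t).
  apply: bmD; apply: bm_sum => i _; first by apply: bmZ; exact: bm_htraces.
  apply: bm_sum => o _; apply: bmZ; apply: bmB; last apply: bmZ; exact: bm_htraces.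
have bE : bm (fun Q => sd_error a Q w t).
  rewrite (_ : (fun _ => _) = (fun Q => (\sum_j \sum_k variation beta a Q (delta_mx j k) w t j k -
     N%:R^-1 * \sum_j variation beta a Q 1%:M w t j j) - sd_main a beta Q w t)).
    exact: bmB.
  by apply/funext => Q; rewrite variation_trace addrAC subrr add0r.
have h : gE (fun Q => sd_main a beta Q w t + sd_error a Q w t) = 0.
  under eq_fun do rewrite -variation_trace.
  rewrite gibbs_expectationE//; rewrite (_ : cintegral _ _ =
    \sum_j \sum_k @ibp R N d L beta sigma a w t (delta_mx j k) j k -
    N%:R^-1 * \sum_j @ibp R N d L beta sigma a w t 1%:M j j); first by rewrite ibp_traceless ?mulr0.
  have bv' (X : 'M[R[i]]_N) (j k : 'I_N) : bm (fun Q => (boltzmann beta Q)%:C%C * variation beta a Q X w t j k).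
    exact: bmM.
  transitivity (cintegral mu (fun Q =>
      \sum_j \sum_k (boltzmann beta Q)%:C%C * variation beta a Q (delta_mx j k) w t j k -
      N%:R^-1 * \sum_j (boltzmann beta Q)%:C%C * variation beta a Q 1%:M w t j j)).
    congr (cintegral _ _); apply/funext => Q.
    rewrite mulrBr; congr (_ - _).
      by rewrite mulr_sumr; apply: eq_bigr => j _; rewrite mulr_sumr.
    by rewrite mulrCA; congr (_ * _); rewrite mulr_sumr.
  rewrite cintegralB; last 2 first.
  - by apply: bm_sum => j _; apply: bm_sum.
  - by apply: bmZ; apply: bm_sum.
  rewrite cintegralZ; last by apply: bm_sum.
  rewrite cintegral_sum; last by move=> j _; apply: bm_sum.
  congr (_ - _).
    by apply: eq_bigr => j _; rewrite cintegral_sum// => k _; exact: bv'.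
  by congr (_ * _); rewrite cintegral_sum// => j _; exact: bv'.
move: h; rewrite gibbsD// => /eqP; rewrite addr_eq0 => /eqP ->.
rewrite modcN; apply: modc_gibbs_le => // Q; exact: modc_sd_error.
Qed.

End gibbs.

(** * The recursion at finite N *)

Section recursion.
Context (R : realType) (d : nat) (beta : R).
Implicit Types (e f : edge d) (b w p : seq (edge d)) (P : seq (seq (edge d))).
Implicit Types (t : seq (seq (edge d))) (o : bool * (seq (edge d) * seq (edge d))).

(** The recursion for the first word e b as a list of real coefficients and
    replacing words; P lists the plaquettes, in both orientations. *)
Definition loop_op e b P : seq (R * seq (seq (edge d))) :=
  [seq (- occ_sign R o, split_words e o) | o <- occ e b] ++
  flatten [seq flatten [seq [:: (- (beta / 2 * occ_sign R o), [:: deform e b o]);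
                               (beta / 2 * occ_sign R o, [:: e :: b; p])]
                       | o <- occ e p]
          | p <- P].

Lemma big_loop_op (V : nmodType) (F : R * seq (seq (edge d)) -> V) e b P :
  \sum_(x <- loop_op e b P) F x =
  \sum_(o <- occ e b) F (- occ_sign R o, split_words e o) +
  \sum_(p <- P) \sum_(o <- occ e p)
    (F (- (beta / 2 * occ_sign R o), [:: deform e b o]) +
     F (beta / 2 * occ_sign R o, [:: e :: b; p])).
Proof.
rewrite /loop_op big_cat big_map; congr (_ + _).
rewrite big_flatten big_map; apply: eq_bigr => p _.
rewrite big_flatten big_map; apply: eq_bigr => o _.
by rewrite big_cons big_seq1.
Qed.

Definition meets e p := (e \in p) || (einv e \in p).

Lemma mem_word_inv e p : (e \in word_inv p) = (einv e \in p).
Proof.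
rewrite /word_inv mem_rev; apply/mapP/idP => [[f fp ->]|ep]; first by rewrite einvK.
by exists (einv e) => //; rewrite einvK.
Qed.

Lemma meets_word_inv e p : meets e (word_inv p) = meets e p.
Proof. by rewrite /meets !mem_word_inv einvK orbC. Qed.

Lemma occ_not_meets e p : ~~ meets e p -> occ e p = [::].
Proof. by rewrite negb_or => /andP[]; exact: occ_nil. Qed.

Lemma big_occ_meets (V : nmodType) (F : seq (edge d) -> _ -> V) e P :
  \sum_(p <- both_orientations P) \sum_(o <- occ e p) F p o =
  \sum_(p <- both_orientations [seq p <- P | meets e p]) \sum_(o <- occ e p) F p o.
Proof.
rewrite !big_both_orientations big_filter [RHS]big_mkcond; apply: eq_bigr => p _.
case: ifPn => // np; rewrite (occ_not_meets np) occ_not_meets ?meets_word_inv//.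
by rewrite !big_nil addr0.
Qed.

Section weight_bound.

(** Occurrences sit at distinct positions. *)
Lemma sum_occ_le (F : nat -> R) e b : (forall i, 0 <= F i) ->
  \sum_(o <- occ e b) F (size o.2.1) <= \sum_(i < size b) F i.
Proof.
elim: b F => [|f b ih] F F0; first by rewrite big_nil big_ord0.
rewrite occ_cons big_cat big_map big_ord_recl /= lerD//.
  by case: ifP => _; [|case: ifP => _]; rewrite ?big_seq1 ?big_nil.
exact: (ih (fun i => F i.+1)).
Qed.

Lemma split_weight e b :
  \sum_(o <- occ e b) weights R (split_words e o) <= 4^-1 * weight R (size b).+1.
Proof.
set n := size b.
pose G i := weight R i.+1 * weight R (n - i.+1).+1 + weight R i * weight R (n - i.+1).
have w0 k : 0 <= weight R k by exact/ltW/weight_gt0.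
have G0 i : 0 <= G i by apply: addr_ge0; apply: mulr_ge0; exact: w0.
apply: (@le_trans _ _ (\sum_(o <- occ e b) G (size o.2.1))).
  rewrite big_seq [leRHS]big_seq; apply: ler_sum => o /size_occP.
  rewrite -/n => so; have -> : G (size o.2.1) =
      weight R (size o.2.1).+1 * weight R (size o.2.2).+1 +
      weight R (size o.2.1) * weight R (size o.2.2).
    by rewrite /G -so subSS addKn.
  rewrite /split_words; case: o.1.
    by rewrite !weights_cons /weights big_nil mulr1 lerDr mulr_ge0.
  by rewrite !weights_cons /weights big_nil mulr1 /= lerDl mulr_ge0.
apply: (le_trans (sum_occ_le e b G0)); rewrite /G big_split.
rewrite [leRHS](_ : _ = 8^-1 * weight R n.+1 + 8^-1 * weight R n.+1); last by lra.
exact: lerD (conv_weight_same R n) (conv_weight_opp R n).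
Qed.

(** The splittings cost at most a quarter of the weight. Each of the at most
    4 M plaquette terms lengthens the word by at most 4 letters or adds a word
    of length 4, at a cost of 1024^4, which the smallness of beta outweighs. *)
Lemma loop_op_weight e b P (M : nat) : (size P <= M)%N -> all (fun p => size p == 4%N) P ->
  `|beta| * (16 * M.+1%:R * growth R ^+ 4) <= 1 ->
  \sum_(x <- loop_op e b P) `|x.1| * weights R x.2 <= 2^-1 * weight R (size b).+1.
Proof.
move=> sP P4; rewrite big_loop_op.
have w0 k : 0 <= weight R k by exact/ltW/weight_gt0.
have K4 n : weight R (n + 4) <= growth R ^+ 4 * weight R n by exact: weight_add.
have K2 n : weight R (n + 2) <= growth R ^+ 4 * weight R n.
  apply: (le_trans (weight_add _ _ _)); by rewrite ler_wpM2r// ler_weXn2l// growth_ge1.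
have K0 := growthX_ge0 R 4.
move: (growth R ^+ 4) K4 K2 K0 => K K4 K2 K0 hb.
have e1 : \sum_(o <- occ e b) `|- occ_sign R o| * weights R (split_words e o) <=
    4^-1 * weight R (size b).+1.
  under eq_bigr => o _ do rewrite normrN normr_occ_sign mul1r.
  exact: split_weight.
pose c := `|beta| * K * weight R (size b).+1.
have c0 : 0 <= c by rewrite mulr_ge0// mulr_ge0.
have e2 : \sum_(p <- P) \sum_(o <- occ e p)
    (`|- (beta / 2 * occ_sign R o)| * weights R [:: deform e b o] +
     `|beta / 2 * occ_sign R o| * weights R [:: e :: b; p]) <= \sum_(p <- P) 4 * c.
  rewrite big_seq [leRHS]big_seq; apply: ler_sum => p pP.
  have p4 : size p = 4%N by apply/eqP; exact: (allP P4).
  apply: (@le_trans _ _ (\sum_(o <- occ e p) c)).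
    rewrite big_seq [leRHS]big_seq; apply: ler_sum => o op.
    have so := size_occP op; rewrite p4 in so.
    rewrite normrN normrM normr_occ_sign mulr1 -mulrDr normrM [ `|2^-1| ]ger0_norm// /c.
    rewrite !weights_cons /weights !big_nil !mulr1 p4.
    have h4 : weight R 4%N <= K by have := K4 0; rewrite add0n [weight R 0]/weight mulr1.
    have hd : weight R (size (deform e b o)) <= K * weight R (size b).+1.
      have [->|->] : size (deform e b o) = ((size b).+1 + 2)%N \/
          size (deform e b o) = ((size b).+1 + 4)%N.
        move: so; rewrite /deform; case: o.1; rewrite !size_cat /=.
          by move: (size o.2.1) (size o.2.2) (size b) => x y z; left; lia.
        by move: (size o.2.1) (size o.2.2) (size b) => x y z; right; lia.
        exact: K2.
      exact: K4.
    have hp := ler_wpM2l (w0 (size b).+1) h4.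
    have bb : 0 <= `|beta| by [].
    have := ler_wpM2l bb (lerD hd hp); rewrite [size (_ :: _)]/=; lra.
  rewrite big_const_seq count_predT iter_addr_0 -[leLHS]mulr_natl ler_wpM2r//.
  by rewrite ler_nat -p4 size_occ.
apply: (le_trans (lerD e1 e2)).
rewrite big_const_seq count_predT iter_addr_0 -mulr_natl.
have hP : (size P)%:R <= M.+1%:R :> R by rewrite ler_nat ltnW.
have h1 : (size P)%:R * (4 * c) <= M.+1%:R * (4 * c) by rewrite ler_wpM2r// mulr_ge0.
have := ler_wpM2r (w0 (size b).+1) hb; rewrite /c in h1 *; lra.
Qed.

End weight_bound.

Section finite_N.
Context (N : nat) (L : {fset vertex d}).
Variable sigma : probability (SU R N) R.
Hypothesis haar : is_haar sigma.
Local Notation cfg := (config R N L).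
Local Notation bm := (@bounded_measurable _ cfg R).
Local Notation gE := (@gibbs_expectation R N d L sigma beta).
Local Notation PP := (both_orientations (plaquettes L)).

Definition normalized_expectation (s : seq (seq (edge d))) : R[i] :=
  gE (fun Q => htraces Q s) / N%:R ^+ size s.
Local Notation phi := normalized_expectation.

Lemma modc_normalized_expectation s : (0 < N)%N -> modc (phi s) <= 2.
Proof.
move=> N0; have NX : 0 < N%:R ^+ size s :> R by rewrite exprn_gt0 ?ltr0n.
rewrite /phi modcM modcV modcX modc_nat ler_pdivrMr//.
by apply: modc_gibbs_le => [|Q]; [exact: bm_htraces|exact: modc_htraces].
Qed.

Lemma phi_nil : phi [::] = 1.
Proof.
rewrite /phi expr0 divr1 -[RHS](@gibbs1 R N d L beta sigma); congr gibbs_expectation.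
by apply/funext => Q; rewrite /htraces big_nil.
Qed.

(** The trace of the identity is N. *)
Lemma phi_cons_nil s : (0 < N)%N -> phi ([::] :: s) = phi s.
Proof.
move=> N0; have N0' : (N%:R : R[i]) != 0 by rewrite pnatr_eq0 -lt0n.
rewrite /phi; under eq_fun do rewrite htraces_cons htrace_nil.
rewrite gibbsZ; last exact: bm_htraces.
by rewrite /= exprS -mulf_div divff// mul1r.
Qed.

Lemma bm_loop_terms e b t : bm (fun Q => loop_terms beta Q e b t).
Proof.
apply: bmD; first apply: bmD; first by apply: bmZ; exact: bm_htraces.
  by apply: bm_sum => o _; apply: bmZ; exact: bm_htraces.
apply: bm_sum => p _; apply: bm_sum => o _; apply: bmZ.
by apply: bmB; [|apply: bmZ]; exact: bm_htraces.
Qed.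

Lemma gibbs_loop_terms e b t : gE (fun Q => loop_terms beta Q e b t) =
  N%:R * gE (fun Q => htraces Q ((e :: b) :: t)) +
  \sum_(o <- occ e b) (occ_sign R o)%:C%C * gE (fun Q => htraces Q (split_words e o ++ t)) +
  \sum_(p <- PP) \sum_(o <- occ e p) (N%:R * beta / 2)%:C%C * (occ_sign R o)%:C%C *
    (gE (fun Q => htraces Q (deform e b o :: t)) -
     N%:R^-1 * gE (fun Q => htraces Q [:: e :: b, p & t])).
Proof.
have bh s : bm (fun Q => htraces Q s) by exact: bm_htraces.
rewrite /loop_terms gibbsD; last 2 first.
- by apply: bmD; [exact: bmZ|apply: bm_sum => o _; exact: bmZ].
- apply: bm_sum => p _; apply: bm_sum => o _; apply: bmZ.
  by apply: bmB; [|exact: bmZ].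
rewrite gibbsD; last 2 first.
- exact: bmZ.
- by apply: bm_sum => o _; exact: bmZ.
rewrite gibbsZ// gibbs_sum; last by move=> o; exact: bmZ.
rewrite gibbs_sum; last first.
  move=> p; apply: bm_sum => o _; apply: bmZ.
  by apply: bmB; [|exact: bmZ].
congr (_ + _ + _); first by apply: eq_bigr => o _; rewrite gibbsZ.
apply: eq_bigr => p _; rewrite gibbs_sum; last first.
  move=> o; apply: bmZ.
  by apply: bmB; [|exact: bmZ].
apply: eq_bigr => o _; rewrite gibbsZ; last by apply: bmB; [|exact: bmZ].
congr (_ * _); under eq_fun do rewrite -mulN1r.
rewrite gibbsD//; last by do 2 apply: bmZ.
by rewrite !gibbsZ ?mulN1r//; exact: bmZ.
Qed.

(** [gibbs_sd] divided by N to the power (size t + 2). *)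
Lemma phi_recursion e b t : (0 < N)%N -> e \in edges L ->
  modc (phi ((e :: b) :: t) - \sum_(x <- loop_op e b PP) x.1%:C%C * phi (x.2 ++ t)) <=
  2 * (2 * totsize t + (size b).+1)%:R / N%:R ^+ 2.
Proof.
move=> N0 eL; have N0' : (N%:R : R[i]) != 0 by rewrite pnatr_eq0 -lt0n.
have NR : 0 < (N%:R : R) by rewrite ltr0n.
have nne : nn e by move: eL; rewrite in_edges => /and3P[].
have h : modc (gE (fun Q => loop_terms beta Q e b t)) <=
    2 * ((2 * totsize t + (size b).+1)%:R * N%:R ^+ size t).
  have [ep|ep] := edges_pos eL.
    rewrite -[(size b).+1]/(size (e :: b)).
    under eq_fun do rewrite -sd_main_pos.
    exact: gibbs_sd.
  have := @gibbs_sd _ _ _ _ beta sigma haar (einv e) (rcons b (einv (einv e))) t N0 ep.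
  rewrite size_rcons; under eq_fun do rewrite sd_main_neg ?einvK 1?eq_sym ?einv_neq//.
  under eq_fun do rewrite -mulN1r.
  by rewrite (gibbsZ beta sigma (-1) (bm_loop_terms e b t)) mulN1r modcN.
have e1 : gE (fun Q => loop_terms beta Q e b t) / N%:R ^+ (size t).+2 =
    phi ((e :: b) :: t) - \sum_(x <- loop_op e b PP) x.1%:C%C * phi (x.2 ++ t).
  rewrite gibbs_loop_terms big_loop_op opprD addrA !mulrDl; congr (_ + _ + _).
  - by rewrite /phi [size (_ :: _)]/= [in LHS]exprS invfM mulrACA divff// mul1r.
  - rewrite mulr_suml -sumrN; apply: eq_bigr => o _.
    rewrite rmorphN mulNr opprK -mulrA; congr (_ * _).
    by rewrite /phi /split_words; case: o.1.
  - rewrite mulr_suml -sumrN; apply: eq_bigr => p _.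
    rewrite mulr_suml -sumrN; apply: eq_bigr => o _.
    rewrite /phi [size ([:: deform e b o] ++ t)]/= [size ([:: _; p] ++ t)]/=.
    have hk : (N%:R * beta / 2)%:C%C = N%:R * (beta / 2)%:C%C :> R[i].
      by rewrite -mulrA rmorphM rmorph_nat.
    have h1 : (- (beta / 2 * occ_sign R o))%:C%C =
      - ((beta / 2)%:C%C * (occ_sign R o)%:C%C) :> R[i] by rewrite rmorphN rmorphM.
    have h2 : (beta / 2 * occ_sign R o)%:C%C =
      (beta / 2)%:C%C * (occ_sign R o)%:C%C :> R[i] by rewrite rmorphM.
    rewrite hk h1 h2; move: (beta / 2)%:C%C (occ_sign R o)%:C%C => b' o'.
    move: (gE (fun Q => htraces Q (deform e b o :: t))) (gE (fun Q => htraces Q [:: e :: b, p & t])) => x y.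
    rewrite !exprS; field.
    by rewrite N0' expf_neq0.
rewrite -e1 modcM modcV modcX modc_nat ler_pdivrMr ?exprn_gt0//.
apply: (le_trans h); move: (_ + _)%N%:R (N%:R : R) NR => A y y0.
rewrite -[(size t).+2]addn2 exprD; move: (y ^+ size t) => z.
rewrite le_eqVlt; apply/orP; left; apply/eqP; field.
by rewrite gt_eqF.
Qed.

End finite_N.
End recursion.

(** * Plaquettes through a given edge *)

Section plaquette_counting.
Variable d : nat.
Implicit Types (L : {fset vertex d}) (e f : edge d) (p : seq (edge d)) (x y : vertex d).

Lemma plaquettes_uniq L : uniq (plaquettes L).
Proof.
rewrite map_inj_uniq ?filter_uniq ?index_enum_uniq// => p q /(inj_map val_inj).
exact: val_inj.
Qed.

Lemma mem_plaquettes L p :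
  (p \in plaquettes L) = pos_plaquette p && all (fun f => f \in edges L) p.
Proof.
apply/mapP/andP => [[q]|[pp pL]].
  rewrite mem_filter => /andP[qp _] ->; split=> //.
  by apply/allP => _ /mapP[f _ ->]; exact: valP.
have p4 : size p == 4%N by case/andP: pp => /and3P[].
have ms : map val (pmap insub p : seq (edges L)) = p.
  rewrite (pmap_filter (@insubK _ _ _)); apply/all_filterP.
  by apply: sub_all pL => f fL; rewrite insubT.
have ps : size (pmap insub p : seq (edges L)) == 4%N by rewrite -(size_map val) ms.
exists (Tuple ps); last by rewrite /= ms.
by rewrite mem_filter mem_index_enum andbT /= ms.
Qed.

Lemma nn_coord f k : nn f -> `|tnth f.1 k - tnth f.2 k| <= 1.
Proof.
move=> /eqP h; apply: (@le_trans _ _ (\sum_(i < d) `|tnth f.1 i - tnth f.2 i|)).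
  rewrite (bigD1 k)//= lerDl.
  by apply: sumr_ge0 => i _; exact: normr_ge0.
by rewrite h.
Qed.

Lemma cyclic_close (x0 x1 x2 x3 c : int) :
  `|x0 - x1| <= 1 -> `|x1 - x2| <= 1 -> `|x2 - x3| <= 1 -> `|x3 - x0| <= 1 ->
  c \in [:: x0; x1; x2; x3] -> forall z, z \in [:: x0; x1; x2; x3] -> `|z - c| <= 4.
Proof.
move=> h0 h1 h2 h3 hc z hz; move: hc hz; rewrite !inE.
by case/or4P => /eqP ->; case/or4P => /eqP ->; lia.
Qed.

(** Consecutive vertices differ by at most 1 in each coordinate and a plaquette
    meeting e contains the vertex e.1. *)
Lemma plaquette_close e p : pos_plaquette p -> meets e p ->
  forall f k, f \in p ->
   `|tnth f.1 k - tnth e.1 k| <= 4 /\ `|tnth f.2 k - tnth e.1 k| <= 4.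
Proof.
move=> /andP[/and3P[/eqP p4 /andP[pn pc] _] _] me f k fp.
case: p p4 pn pc me fp => [|f0 [|f1 [|f2 [|f3 [|]]]]]//= _.
move=> /and5P[n0 n1 n2 n3 _] /and5P[/eqP c0 /eqP c1 /eqP c2 /eqP c3 _] me fp.
have h0 := nn_coord k n0; have h1 := nn_coord k n1.
have h2 := nn_coord k n2; have h3 := nn_coord k n3.
have vs g : g \in [:: f0; f1; f2; f3] ->
    tnth g.1 k \in [:: tnth f0.1 k; tnth f1.1 k; tnth f2.1 k; tnth f3.1 k] /\
    tnth g.2 k \in [:: tnth f0.1 k; tnth f1.1 k; tnth f2.1 k; tnth f3.1 k].
  by rewrite !inE => /or4P[] /eqP ->; rewrite ?c0 ?c1 ?c2 ?c3 !eqxx ?orbT.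
rewrite c0 in h0; rewrite c1 in h1; rewrite c2 in h2; rewrite c3 in h3.
have ce : tnth e.1 k \in [:: tnth f0.1 k; tnth f1.1 k; tnth f2.1 k; tnth f3.1 k].
  by case/orP: me => /vs[].
have [v1 v2] := vs _ fp.
by split; apply: (cyclic_close h0 h1 h2 h3 ce).
Qed.

Definition offset_code e x : d.-tuple 'I_9 :=
  [tuple inord (absz (tnth x k - tnth e.1 k + 4)%R) | k < d].

Lemma offset_code_inj e x y :
  (forall k, `|tnth x k - tnth e.1 k| <= 4) ->
  (forall k, `|tnth y k - tnth e.1 k| <= 4) ->
  offset_code e x = offset_code e y -> x = y.
Proof.
move=> hx hy exy; apply: eq_from_tnth => k.
have := congr1 (fun t => val (tnth t k)) exy; rewrite !tnth_mktuple /=.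
have := hx k; have := hy k; move: (tnth x k) (tnth y k) (tnth e.1 k) => a b c h1 h2.
by rewrite !inordK; lia.
Qed.

(** The vertices of a plaquette through e relative to e.1, each coordinate
    shifted by 4 to lie in {0, ..., 8}: this finite code does not depend on the
    position of e in the lattice. *)
Definition plaquette_code e p : 4.-tuple (d.-tuple 'I_9 * d.-tuple 'I_9) :=
  [tuple (offset_code e (nth e p i).1, offset_code e (nth e p i).2) | i < 4].

(** A bound that depends neither on the edge nor on the finite box. *)
Definition max_touching : nat := #|{: 4.-tuple (d.-tuple 'I_9 * d.-tuple 'I_9)}|.

Definition touching L e := [seq p <- plaquettes L | meets e p].

Lemma touchingP L e p : p \in touching L e ->
  pos_plaquette p /\ meets e p.
Proof. by rewrite mem_filter mem_plaquettes => /andP[-> /andP[->]]. Qed.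

Lemma pos_plaquette_size p : pos_plaquette p -> size p = 4%N.
Proof. by move=> /andP[/and3P[/eqP]]. Qed.

Lemma plaquette_code_inj e : {in [pred p | pos_plaquette p && meets e p] &,
  injective (plaquette_code e)}.
Proof.
move=> p q /andP[pp pm] /andP[qp qm] pq.
have p4 := pos_plaquette_size pp; have q4 := pos_plaquette_size qp.
apply: (@eq_from_nth _ e); first by rewrite p4 q4.
rewrite p4 => i i4.
have h1 := congr1 (fun t => (tnth t (Ordinal i4)).1) pq.
have h2 := congr1 (fun t => (tnth t (Ordinal i4)).2) pq.
rewrite !tnth_mktuple in h1 h2.
have ip : nth e p i \in p by rewrite mem_nth// p4.
have iq : nth e q i \in q by rewrite mem_nth// q4.
have hp := plaquette_close pp pm _ ip; have hq := plaquette_close qp qm _ iq.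
have x1 : (nth e p i).1 = (nth e q i).1.
  exact: (offset_code_inj (fun k => (hp k).1) (fun k => (hq k).1) h1).
have x2 : (nth e p i).2 = (nth e q i).2.
  exact: (offset_code_inj (fun k => (hp k).2) (fun k => (hq k).2) h2).
by rewrite [LHS]surjective_pairing x1 x2 -surjective_pairing.
Qed.

Lemma size_touching L e : (size (touching L e) <= max_touching)%N.
Proof.
rewrite -(size_map (plaquette_code e)).
have u : uniq (map (plaquette_code e) (touching L e)).
  rewrite map_inj_in_uniq ?filter_uniq ?plaquettes_uniq// => p q.
  move=> /touchingP[pp pm] /touchingP[qp qm]; apply: plaquette_code_inj.
    by rewrite inE pp.
  by rewrite inE qp.
by rewrite -(card_uniqP u) max_card.
Qed.

Lemma touching_subset L L' e : (L `<=` L')%fset -> {subset touching L e <= touching L' e}.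
Proof.
move=> /fsubsetP LL p; rewrite !mem_filter !mem_plaquettes => /and3P[-> -> /allP pL] /=.
apply/allP => f /pL; rewrite !in_edges => /and3P[f1 f2 ->].
by rewrite !LL.
Qed.

(** A growing sequence of sets of bounded size is eventually constant: take
    the index at which the size is maximal. *)
Lemma touching_stable (L : nat -> {fset vertex d}) e :
  (forall i j, (0 < i)%N -> (i <= j)%N -> (L i `<=` L j)%fset) ->
  exists2 N0, (0 < N0)%N & forall N, (N0 <= N)%N ->
    perm_eq (touching (L N) e) (touching (L N0) e).
Proof.
move=> Lmono.
pose att k := `[< exists2 N, (0 < N)%N & size (touching (L N) e) = k >].
have ex : exists k, att k by exists (size (touching (L 1%N) e)); apply/asboolP; exists 1%N.
have ub k : att k -> (k <= max_touching)%N by move=> /asboolP[N _ <-]; exact: size_touching.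
case: (ex_maxnP ex ub) => k /asboolP[N0 N00 sN0] kmax.
exists N0 => // N NN; have sub := @touching_subset _ _ e (Lmono _ _ N00 NN).
have uN M : uniq (touching (L M) e) by rewrite filter_uniq// plaquettes_uniq.
have sz : (size (touching (L N) e) <= size (touching (L N0) e))%N.
  rewrite sN0; apply: kmax; apply/asboolP; exists N => //.
  exact: leq_trans N00 NN.
have [_ eqi] := uniq_min_size (uN N0) sub sz.
by rewrite perm_sym; apply: uniq_perm.
Qed.

End plaquette_counting.

(** * Limits of complex sequences *)

Section complex_limits.
Context (R : realType).
Implicit Types (z : nat -> R[i]) (l : R[i]).

(** The coefficients of the recursion are real, so the real and imaginary parts
    satisfy it separately. *)
Lemma complex_contraction_cvg0 (E I : Type) (F : set_system I) (FF : Filter F)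
    (g : I -> seq (seq E) -> R[i]) (C : R) :
  (forall i s, modc (g i s) <= C) ->
  (\forall i \near F, g i [::] = 0) ->
  (forall s, \forall i \near F, g i ([::] :: s) = g i s) ->
  (forall e w, exists op : seq (R * seq (seq E)),
     \sum_(x <- op) `|x.1| * weights R x.2 <= 2^-1 * weight R (size w).+1 /\
     forall t (eps : R), 0 < eps -> \forall i \near F,
       modc (g i ((e :: w) :: t) - \sum_(x <- op) x.1%:C%C * g i (x.2 ++ t)) <= eps) ->
  forall s (eps : R), 0 < eps -> \forall i \near F, modc (g i s) <= eps.
Proof.
move=> gC g0 gnil gop.
have part (h : R[i] -> R) : (forall x, `|h x| <= modc x) -> h 0 = 0 ->
    (forall x y, h (x + y) = h x + h y) -> (forall x, h (- x) = - h x) ->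
    (forall c x, h (c%:C%C * x) = c * h x) ->
    forall s (eps : R), 0 < eps -> \forall i \near F, `|h (g i s)| <= eps.
  move=> hle h0 hD hN hZ; apply: (@contraction_cvg0 R E I F FF (fun i s => h (g i s)) C).
  - by move=> i s; exact: le_trans (hle _) (gC i s).
  - by apply: filterS g0 => i ->.
  - by move=> s; apply: filterS (gnil s) => i ->.
  move=> e w; have [op [opw opg]] := gop e w; exists op; split=> // t eps eps0.
  apply: filterS (opg t eps eps0) => i hi; apply: le_trans hi.
  have hS (r : seq (R * seq (seq E))) : h (\sum_(x <- r) x.1%:C%C * g i (x.2 ++ t)) =
      \sum_(x <- r) x.1 * h (g i (x.2 ++ t)).
    by elim: r => [|x r ih]; rewrite ?big_nil// !big_cons hD hZ ih.
  by rewrite -hS -hN -hD.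
move=> s eps eps0; have e2 : 0 < eps / 2 by rewrite divr_gt0.
have hr := @part (@complex.Re R) (@Re_le_modc R) erefl (@complexReD R).
have hi := @part (@complex.Im R) (@Im_le_modc R) erefl (@complexImD R).
have {}hr := hr _ _ s _ e2; have {}hi := hi _ _ s _ e2.
apply: filterS2 (hr _ _) (hi _ _).
- by move=> i h1 h2; apply: (le_trans (modc_le _)); lra.
- by case.
- by move=> c x; rewrite complexReM /= mul0r subr0.
- by case.
- by move=> c x; rewrite complexImM /= mul0r addr0.
Qed.

Lemma cvg_modc z l : (forall eps : R, 0 < eps -> \forall n \near \oo, modc (z n - l) <= eps) ->
  z @ \oo --> l.
Proof.
move=> h A [e /= e0 eA].
have eR : e = (complex.Re e)%:C%C by rewrite RRe_real// gtr0_real.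
have e1 : 0 < complex.Re e / 2 by rewrite divr_gt0// -ltcR -eR.
apply: filterS (h _ e1) => n hn; apply: eA.
rewrite /ball_ /= -modcE eR ltcR -modcN opprB (le_lt_trans hn)//.
by rewrite ltr_pdivrMr// ltr_pMr ?ltr1n// -ltcR -eR.
Qed.

Lemma cauchy_modc_cvg z :
  (forall eps : R, 0 < eps -> exists n0, forall n m, (n0 <= n)%N -> (n0 <= m)%N ->
     modc (z n - z m) <= eps) -> exists l, z @ \oo --> l.
Proof.
move=> h.
have part (f : R[i] -> R) : (forall x, `|f x| <= modc x) ->
    (forall x y, f (x - y) = f x - f y) -> cvgn (fun n => f (z n)).
  move=> fle fB; apply/cauchy_cvgP/cauchy_ballP => e e0.
  have e2 : 0 < e / 2 by rewrite divr_gt0.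
  have [n0 hn] := h _ e2.
  exists ([set f (z n) | n in [set n | (n0 <= n)%N]], [set f (z n) | n in [set n | (n0 <= n)%N]]).
    by split; exists n0 => // n /= nn0; exists n.
  move=> [_ _] [/= [n nn <-] [m mm <-]]; rewrite /ball /= -fB.
  apply: (le_lt_trans (fle _)); apply: (le_lt_trans (hn _ _ nn mm)); lra.
have cr := part (@complex.Re R) (@Re_le_modc R) (ltac:(by case=> ? ?; case)).
have ci := part (@complex.Im R) (@Im_le_modc R) (ltac:(by case=> ? ?; case)).
exists (Complex (limn (fun n => complex.Re (z n))) (limn (fun n => complex.Im (z n)))).
apply: cvg_modc => eps eps0; have e2 : 0 < eps / 2 by rewrite divr_gt0.
move/cvgrPdist_le : cr => /(_ _ e2) cr; move/cvgrPdist_le : ci => /(_ _ e2) ci.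
apply: filterS2 cr ci => n h1 h2; apply: (le_trans (modc_le _)).
case: (z n) h1 h2 => a b /= h1 h2; rewrite distrC in h1; rewrite distrC in h2; lra.
Qed.

End complex_limits.

(** * The large-N limit *)

Section large_N.
Context (R : realType) (d : nat) (beta : R).
Variable sigma : forall N : nat, probability (SU R N) R.
Hypothesis haar : forall N, is_haar (sigma N).
Variable L : nat -> {fset vertex d}.
Hypothesis Lmono : forall i j : nat, (0 < i)%N -> (i <= j)%N -> (L i `<=` L j)%fset.
Hypothesis Lcover : forall x : vertex d, exists2 j : nat, (0 < j)%N & x \in L j.
Hypothesis beta_small :
  `|beta| * (16 * (2 * max_touching d).+1%:R * growth R ^+ 4) <= 1.
Implicit Types (e f : edge d) (b w : seq (edge d)) (s t : seq (seq (edge d))).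

Definition phiN N s : R[i] := @normalized_expectation R d beta N (L N) (sigma N) s.

Lemma eventually_edge e : nn e -> exists2 n0, (0 < n0)%N &
  forall N, (n0 <= N)%N -> e \in edges (L N).
Proof.
move=> ne; have [i i0 ei] := Lcover e.1; have [j j0 ej] := Lcover e.2.
exists (maxn i j) => [|N]; first by rewrite leq_max i0.
rewrite geq_max => /andP[iN jN]; rewrite in_edges ne andbT.
by rewrite (fsubsetP (Lmono i0 iN))// (fsubsetP (Lmono j0 jN)).
Qed.

(** Pairs that are not edges carry the identity matrix, so the recursion for
    words that start with them is trivial. *)
Lemma phiN_nonedge N e b t : ~~ nn e -> phiN N ((e :: b) :: t) = phiN N (b :: t).
Proof.
move=> ne; rewrite /phiN /normalized_expectation /=; congr (gibbs_expectation _ _ _ / _).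
apply/funext => Q; rewrite !htraces_cons; congr (_ * _).
have e1 : edge_mx Q e = 1%:M.
  by rewrite /edge_mx !in_pos_edges edges_einv in_edges (negPf ne) !andbF.
by rewrite /htrace path_mx_cons e1 mul1mx.
Qed.

(** For N large the edge e belongs to Lambda_N and the plaquettes through it no
    longer change, so the operator of the recursion is independent of N. *)
Lemma limit_recursion e b : exists op : seq (R * seq (seq (edge d))),
  \sum_(x <- op) `|x.1| * weights R x.2 <= 2^-1 * weight R (size b).+1 /\
  forall t (eps : R), 0 < eps -> \forall N \near \oo,
    modc (phiN N ((e :: b) :: t) - \sum_(x <- op) x.1%:C%C * phiN N (x.2 ++ t)) <= eps.
Proof.
(* A pair that is not an edge is dropped; the weight decreases by a factor 4. *)
have [ne|ne] := boolP (nn e); last first.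
  exists [:: (1, [:: b])]; split.
    rewrite big_seq1 [_.1]/= [_.2]/= normr1 mul1r weights_cons /weights big_nil mulr1.
    have := weight_step R (size b); have := weight_gt0 R (size b).+1; lra.
  move=> t eps eps0; near=> N.
  by rewrite phiN_nonedge// big_seq1 rmorph1 mul1r subrr modc0 ltW.
have [n1 n10 eL] := eventually_edge ne.
have [n0 n00 stable] := touching_stable e Lmono.
set P := touching (L n0) e.
exists (loop_op beta e b (both_orientations P)); split.
  apply: (@loop_op_weight _ _ _ _ _ _ (2 * max_touching d)) => //.
    have -> : size (both_orientations P) = (2 * size P)%N.
      by rewrite /both_orientations; elim: (P) => //= p r ->; rewrite mulnS.
    by rewrite leq_mul2l size_touching orbT.
  apply/allP => p /flattenP[_ /mapP[q qP ->]].
  have q4 : size q == 4%N by apply/eqP/pos_plaquette_size; have [] := touchingP qP.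
  by rewrite !inE => /orP[] /eqP -> //; rewrite /word_inv size_rev size_map.
move=> t eps eps0; set A : R := 2 * (2 * totsize t + (size b).+1)%:R.
have A0 : 0 <= A by rewrite mulr_ge0.
near=> N.
have N1 : (n1 <= N)%N by near: N; exact: nbhs_infty_ge.
have N0 : (n0 <= N)%N by near: N; exact: nbhs_infty_ge.
have Ngt0 : (0 < N)%N by exact: leq_trans n00 N0.
have NA : A / eps <= N%:R by near: N; exact: nbhs_infty_ger.
have -> : \sum_(x <- loop_op beta e b (both_orientations P)) x.1%:C%C * phiN N (x.2 ++ t) =
    \sum_(x <- loop_op beta e b (both_orientations (plaquettes (L N))))
      x.1%:C%C * phiN N (x.2 ++ t).
  rewrite !big_loop_op; congr (_ + _).
  rewrite [RHS](big_occ_meets _ e (plaquettes (L N))) !big_both_orientations.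
  by rewrite [RHS](perm_big _ (stable N N0)).
have hr := phi_recursion beta (@haar N) b t Ngt0 (eL N N1).
apply: (le_trans hr).
rewrite -/A; have Nr : 0 < (N%:R : R) by rewrite ltr0n.
rewrite ler_pdivrMr ?exprn_gt0//; rewrite ler_pdivrMr// in NA.
apply: (le_trans NA); rewrite mulrC ler_wpM2l ?(ltW eps0)//.
by rewrite expr2 ler_peMl ?(ltW Nr)// ler1n.
Unshelve. all: by end_near. Qed.

Lemma phiN_bounded N s : (0 < N)%N -> modc (phiN N s) <= 2.
Proof. exact: modc_normalized_expectation. Qed.

(** The contraction principle for phi_N - phi_M along pairs (N, M); indices are
    shifted by one because the bounds need N > 0. *)
Lemma phiN_cauchy s (eps : R) : 0 < eps -> exists n0, forall n m,
  (n0 <= n)%N -> (n0 <= m)%N -> modc (phiN n s - phiN m s) <= eps.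
Proof.
move=> eps0.
pose F := filter_prod (\oo : set_system nat) (\oo : set_system nat).
pose g (i : nat * nat) s := phiN i.1.+1 s - phiN i.2.+1 s.
have fstF (P : set nat) : (\forall N \near \oo, P N) -> \forall i \near F, P i.1.+1.
  by move=> [n _ hn]; exists ([set k | (n <= k)%N], [set k | (n <= k)%N]);
    [split; exists n|move=> [i j] /= [ni _]; apply: hn; rewrite /= (leq_trans ni)].
have sndF (P : set nat) : (\forall N \near \oo, P N) -> \forall i \near F, P i.2.+1.
  by move=> [n _ hn]; exists ([set k | (n <= k)%N], [set k | (n <= k)%N]);
    [split; exists n|move=> [i j] /= [_ nj]; apply: hn; rewrite /= (leq_trans nj)].
have key : forall s (eps : R), 0 < eps -> \forall i \near F, modc (g i s) <= eps.
  apply: (@complex_contraction_cvg0 R (edge d) _ F _ g 4).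
- by move=> i u; apply: (le_trans (modcB _ _)); have := @phiN_bounded i.1.+1 u isT;
    have := @phiN_bounded i.2.+1 u isT; lra.
- by near=> i; rewrite /g /phiN !phi_nil subrr.
- by move=> u; near=> i; rewrite /g /phiN !phi_cons_nil.
- move=> e w; have [op [opw opg]] := limit_recursion e w; exists op; split=> // t e0 e00.
  have e2 : 0 < e0 / 2 by rewrite divr_gt0.
  apply: filterS2 (fstF _ (opg t _ e2)) (sndF _ (opg t _ e2)) => i h1 h2.
  rewrite /g.
  have -> : \sum_(x <- op) x.1%:C%C * (phiN i.1.+1 (x.2 ++ t) - phiN i.2.+1 (x.2 ++ t)) =
     \sum_(x <- op) x.1%:C%C * phiN i.1.+1 (x.2 ++ t) -
     \sum_(x <- op) x.1%:C%C * phiN i.2.+1 (x.2 ++ t).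
    by rewrite -sumrB; apply: eq_bigr => x _; rewrite mulrBr.
  move: h1 h2.
  move: (phiN i.1.+1 ((e :: w) :: t)) (\sum_(x <- op) _ * phiN i.1.+1 _) => a a'.
  move: (phiN i.2.+1 ((e :: w) :: t)) (\sum_(x <- op) _) => b b' h1 h2.
  rewrite (_ : _ - _ = (a - a') - (b - b')); last by ring.
  by apply: (le_trans (modcB _ _)); lra.
have [[A B] /= [[n _ hn] [m _ hm]] AB] := key s eps eps0.
exists (maxn n m).+1 => -[//|i] [//|j] ni mj.
move: ni mj; rewrite !ltnS !geq_max => /andP[ni _] /andP[_ mj].
by apply: (AB (i, j)); split; [exact: hn|exact: hm].
Unshelve. all: by end_near. Qed.

Definition phi_lim s : R[i] := limn (phiN ^~ s).

Lemma phi_cvg s : phiN ^~ s @ \oo --> phi_lim s.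
Proof.
have [l hl] := cauchy_modc_cvg (phiN_cauchy s).
by apply/cvg_ex; exists l.
Qed.

(** The contraction principle for phi_N(s ++ t) - phi_N(s) phi_N(t) as a function
    of s: both terms satisfy the recursion since it only changes the first
    word. *)
Lemma phi_factor s t (eps : R) : 0 < eps ->
  \forall N \near \oo, modc (phiN N (s ++ t) - phiN N s * phiN N t) <= eps.
Proof.
move=> eps0.
pose g (n : nat) u := phiN n.+1 (u ++ t) - phiN n.+1 u * phiN n.+1 t.
have shift (P : set nat) : (\forall N \near \oo, P N) -> \forall N \near \oo, P N.+1.
  by move=> [n _ hn]; exists n => // m /= nm; apply: hn; rewrite /= (leq_trans nm).
have key : forall s (eps : R), 0 < eps -> \forall i \near \oo, modc (g i s) <= eps.
  apply: (@complex_contraction_cvg0 R (edge d) _ (\oo : set_system nat) _ g 6).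
- move=> n u; apply: (le_trans (modcB _ _)); rewrite modcM.
  have h1 := @phiN_bounded n.+1 u isT; have h2 := @phiN_bounded n.+1 t isT.
  have h3 := @phiN_bounded n.+1 (u ++ t) isT.
  have := ler_pM (modc_ge0 _) (modc_ge0 _) h1 h2; lra.
- by near=> n; rewrite /g /= /phiN phi_nil mul1r subrr.
- by move=> u; near=> n; rewrite /g cat_cons /phiN !phi_cons_nil.
- move=> e w; have [op [opw opg]] := limit_recursion e w; exists op; split=> // v e0 e00.
  have e3 : 0 < e0 / 3 by rewrite divr_gt0.
  apply: filterS2 (shift _ (opg (v ++ t) _ e3)) (shift _ (opg v _ e3)) => n h1 h2.
  rewrite /g cat_cons.
  have -> : \sum_(x <- op) x.1%:C%C * (phiN n.+1 ((x.2 ++ v) ++ t) -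
        phiN n.+1 (x.2 ++ v) * phiN n.+1 t) =
     \sum_(x <- op) x.1%:C%C * phiN n.+1 (x.2 ++ (v ++ t)) -
     (\sum_(x <- op) x.1%:C%C * phiN n.+1 (x.2 ++ v)) * phiN n.+1 t.
    rewrite mulr_suml -sumrB; apply: eq_bigr => x _.
    by rewrite mulrBr catA; congr (_ - _); exact: mulrA.
  have hc : modc (phiN n.+1 t) <= 2 by exact: phiN_bounded.
  move: h1 h2 hc.
  move: (phiN n.+1 ((e :: w) :: v ++ t)) (\sum_(x <- op) _ * phiN _ (x.2 ++ v ++ t)) => a a'.
  move: (phiN n.+1 ((e :: w) :: v)) (\sum_(x <- op) _) (phiN n.+1 t) => b b' c h1 h2 hc.
  rewrite (_ : _ - _ = (a - a') - (b - b') * c); last by ring.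
  apply: (le_trans (modcB _ _)); rewrite modcM.
  have := ler_pM (modc_ge0 _) (modc_ge0 _) h2 hc; lra.
have [n _ hn] := key s eps eps0.
by exists n.+1 => // -[//|m] /= nm; exact: hn.
Unshelve. all: by end_near. Qed.

Lemma phi_lim_cat s t : phi_lim (s ++ t) = phi_lim s * phi_lim t.
Proof.
have h0 : (fun N => phiN N (s ++ t) - phiN N s * phiN N t) @ \oo --> (0 : R[i]).
  apply: cvg_modc => eps eps0; apply: filterS (phi_factor s t eps0) => N.
  by rewrite subr0.
have hm := @cvgM R[i] _ _ _ _ _ _ _ (@phi_cvg s) (@phi_cvg t).
have h := @cvgD _ R[i] _ (\oo : set_system nat) _ _ _ _ _ h0 (hm _).
rewrite add0r in h; apply: (cvg_unique (@norm_hausdorff _ R[i]) (@phi_cvg (s ++ t))).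
have -> : phiN^~ (s ++ t) = (fun N => phiN N (s ++ t) - phiN N s * phiN N t +
    phiN N s * phiN N t) by apply/funext => N; rewrite subrK.
exact: h.
Qed.

End large_N.

Theorem corollary4p3 (R : realType) (d : nat) (hd : (2 <= d)%N) :
  exists2 beta0 : R, 0 < beta0 &
  forall (beta : R), `|beta| <= beta0 ->
  forall (sigma : forall N : nat, probability (SU R N) R),
    (forall N, is_haar (sigma N)) ->
  forall (L : nat -> {fset vertex d}),
    (forall i j : nat, (0 < i)%N -> (i <= j)%N -> (L i `<=` L j)%fset) ->
    (forall x : vertex d, exists2 j : nat, (0 < j)%N & x \in L j) ->
  forall ls : seq (loop d),
  let phi_prod (N : nat) : R[i] :=
    gibbs_expectation (sigma N) beta
      (fun Q : config R N (L N) => \prod_(l <- ls) wilson l Q)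
      / N%:R ^+ size ls in
  let phi (l : loop d) (N : nat) : R[i] :=
    gibbs_expectation (sigma N) beta
      (fun Q : config R N (L N) => wilson l Q) / N%:R in
  [/\ cvgn phi_prod,
      (forall l, l \in ls -> cvgn (phi l)) &
      limn phi_prod = \prod_(l <- ls) limn (phi l)].
Proof.
have K0 : 0 < 16 * (2 * max_touching d).+1%:R * growth R ^+ 4.
  apply: mulr_gt0; first by rewrite mulr_gt0 ?ltr0n.
  by apply: exprn_gt0; exact: lt_le_trans (growth_ge1 R).
exists (16 * (2 * max_touching d).+1%:R * growth R ^+ 4)^-1; first by rewrite invr_gt0.
move=> beta hbeta sigma haar L Lmono Lcover ls phi_prod phi.
have beta_small : `|beta| * (16 * (2 * max_touching d).+1%:R * growth R ^+ 4) <= 1.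
  by rewrite -ler_pdivlMr// mul1r.
pose word (l : loop d) : seq (edge d) := val (repr l).
have phiE l : phi l = phiN beta sigma L ^~ [:: word l].
  apply/funext => N; rewrite /phi /phiN /normalized_expectation expr1.
  by congr (gibbs_expectation _ _ _ / _); apply/funext => Q; rewrite /htraces big_seq1.
have phi_prodE : phi_prod = phiN beta sigma L ^~ [seq word l | l <- ls].
  apply/funext => N; rewrite /phi_prod /phiN /normalized_expectation size_map.
  by congr (gibbs_expectation _ _ _ / _); apply/funext => Q; rewrite /htraces big_map.
have cv s := phi_cvg haar Lmono Lcover beta_small (s := s).
split.
- by rewrite phi_prodE; apply/cvg_ex; eexists; exact: cv.
- by move=> l _; rewrite phiE; apply/cvg_ex; eexists; exact: cv.
rewrite phi_prodE; under eq_bigr do rewrite phiE.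
have -> : \prod_(l <- ls) limn (phiN beta sigma L ^~ [:: word l]) =
    \prod_(w <- [seq word l | l <- ls]) phi_lim beta sigma L [:: w].
  by rewrite big_map.
rewrite -/(phi_lim beta sigma L _); elim: (map word ls) => [|w s ih].
  rewrite big_nil /phi_lim (_ : phiN _ _ _ ^~ [::] = fun=> 1).
    by apply: lim_cst; exact: norm_hausdorff.
  by apply/funext => N; exact: phi_nil.
by rewrite big_cons -ih -(phi_lim_cat haar Lmono Lcover beta_small).
Qed.
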